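(* Let $\mathbf{C}$ be an adhesive category in which all final pullback complements (FPCs) along monomorphisms exist and in which monomorphisms are stable under FPCs. Let $p_1,p_2,p_3\in\mathrm{Lin}(\mathbf{C})$. Then there exists a bijective correspondence between pairs of SqPO-admissible matches $(\mathbf{m}_{21},\mathbf{m}_{3(21)})$, with $\mathbf{m}_{21}\in\mathsf{M}_{p_2}(p_1)$ and $\mathbf{m}_{3(21)}\in\mathsf{M}_{p_3}(p_2{}^{\mathbf{m}_{21}}\!\circ p_1)$, and pairs $(\mathbf{m}_{32},\mathbf{m}_{(32)1})$, with $\mathbf{m}_{32}\in\mathsf{M}_{p_3}(p_2)$ and $\mathbf{m}_{(32)1}\in\mathsf{M}_{p_3{}^{\mathbf{m}_{32}}\circ p_2}(p_1)$, such that for corresponding pairs $$p_3{}^{\mathbf{m}_{3(21)}}\!\circ\left(p_2{}^{\mathbf{m}_{21}}\!\circ p_1\right)\;\cong\;\left(p_3{}^{\mathbf{m}_{32}}\!\circ p_2\right){}^{\mathbf{m}_{(32)1}}\!\circ p_1.$$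
   Context: A category is adhesive if it has pushouts along monomorphisms, has pullbacks, and pushouts along monomorphisms are van Kampen squares. Final pullback complement (FPC): given $a:A\to B$, $c:B\to C$, a pair $(d:D\to C,\ b:A\to D)$ is an FPC of $(c,a)$ if $c\circ a=d\circ b$, this square is a pullback, and for all $x:E\to B$, $y:E\to F$, $z:F\to C$, $w:E\to A$ such that $(E,x,y)$ is a pullback of $(c,z)$ and $a\circ w=x$, there is a unique $w^*:F\to D$ with $d\circ w^*=z$, $w^*\circ y=b\circ w$. ''All FPCs along monomorphisms exist'' means for every composable pair of monomorphisms $K\xrightarrow{i}I\xrightarrow{m}X$ an FPC of $(m,i)$ exists; ''stable under FPCs'' means these FPCs consist of monomorphisms. $\mathrm{Lin}(\mathbf{C})$: isomorphism classes of spans of monomorphisms $p=(O\xleftarrow{o}K\xrightarrow{i}I)$ (linear rules). SqPO composition: for $p_j=(O_j\xleftarrow{o_j}K_j\xrightarrow{i_j}I_j)$, $j=1,2$, a span of monomorphisms $\mathbf{m}=(I_2\xleftarrow{m_2}M_{21}\xrightarrow{m_1}O_1)$ (spans differing by an isomorphism of $M_{21}$ compatible with both legs identified) is an SqPO-admissible match of $p_2$ into $p_1$, written $\mathbf{m}\in\mathsf{M}_{p_2}(p_1)$, if, with $I_2\xrightarrow{n_2}N_{21}\xleftarrow{n_1}O_1$ the pushout of $\mathbf{m}$, there is a pushout complement $K_1\xrightarrow{k_1}\overline{K}_1\xrightarrow{o_1'}N_{21}$ of $K_1\xrightarrow{o_1}O_1\xrightarrow{n_1}N_{21}$ (making $(K_1,O_1,N_{21},\overline{K}_1)$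 a pushout). Then take the FPC $(i_2':\overline{K}_2\to N_{21},k_2:K_2\to\overline{K}_2)$ of $(n_2,i_2)$; the pushout $O_{21}$ (with $o_2':\overline{K}_2\to O_{21}$) of $O_2\xleftarrow{o_2}K_2\xrightarrow{k_2}\overline{K}_2$; the pushout $I_{21}$ (with $i_1':\overline{K}_1\to I_{21}$) of $I_1\xleftarrow{i_1}K_1\xrightarrow{k_1}\overline{K}_1$; and the pullback $K_{21}$ (with $i_2'':K_{21}\to\overline{K}_2$, $o_1'':K_{21}\to\overline{K}_1$) of $\overline{K}_2\xrightarrow{i_2'}N_{21}\xleftarrow{o_1'}\overline{K}_1$. The composite is $p_2{}^{\mathbf{m}}\!\circ p_1:=(O_{21}\xleftarrow{o_2'\circ i_2''}K_{21}\xrightarrow{i_1'\circ o_1''}I_{21})\in\mathrm{Lin}(\mathbf{C})$. *)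

(* Defs.v *)
Set Implicit Arguments.
Unset Strict Implicit.

Record Cat := {
  Ob :> Type;
  Hom : Ob -> Ob -> Type;
  idm : forall A, Hom A A;
  cmp : forall A B C, Hom B C -> Hom A B -> Hom A C;
  cmp_assoc : forall A B C D (h : Hom C D) (g : Hom B C) (f : Hom A B),
      cmp h (cmp g f) = cmp (cmp h g) f;
  cmp_id_l : forall A B (f : Hom A B), cmp (idm B) f = f;
  cmp_id_r : forall A B (f : Hom A B), cmp f (idm A) = f
}.
Arguments Hom {c} _ _.
Arguments idm {c} _.
Arguments cmp {c A B C} _ _.

Notation "g ⊚ f" := (cmp g f) (at level 40, left associativity).

Section CatDefs.
Context {C : Cat}.

Definition mono {A B : C} (f : Hom A B) : Prop :=
  forall (X : C) (g h : Hom X A), f ⊚ g = f ⊚ h -> g = h.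

Definition is_iso {A B : C} (f : Hom A B) : Prop :=
  exists g : Hom B A, g ⊚ f = idm A /\ f ⊚ g = idm B.

Definition is_pullback {A B D P : C} (f : Hom A D) (g : Hom B D)
    (p1 : Hom P A) (p2 : Hom P B) : Prop :=
  f ⊚ p1 = g ⊚ p2 /\
  forall (X : C) (x1 : Hom X A) (x2 : Hom X B), f ⊚ x1 = g ⊚ x2 ->
    exists! u : Hom X P, p1 ⊚ u = x1 /\ p2 ⊚ u = x2.

Definition is_pushout {A B B' Q : C} (f : Hom A B) (g : Hom A B')
    (q1 : Hom B Q) (q2 : Hom B' Q) : Prop :=
  q1 ⊚ f = q2 ⊚ g /\
  forall (X : C) (x1 : Hom B X) (x2 : Hom B' X), x1 ⊚ f = x2 ⊚ g ->
    exists! u : Hom Q X, u ⊚ q1 = x1 /\ u ⊚ q2 = x2.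

(** van Kampen square: the pushout square (f, m, q1, q2) is the bottom face;
    for every commutative cube over it whose back faces are pullbacks, the
    top face is a pushout iff the front faces are pullbacks. *)
Definition is_VK {A B B' D : C} (f : Hom A B) (m : Hom A B')
    (q1 : Hom B D) (q2 : Hom B' D) : Prop :=
  is_pushout f m q1 q2 /\
  forall (A1 B1 B1' D1 : C) (a : Hom A1 A) (b : Hom B1 B) (c : Hom B1' B')
    (d : Hom D1 D) (f1 : Hom A1 B1) (m1 : Hom A1 B1') (q11 : Hom B1 D1)
    (q21 : Hom B1' D1),
    q11 ⊚ f1 = q21 ⊚ m1 ->
    b ⊚ f1 = f ⊚ a -> c ⊚ m1 = m ⊚ a ->
    d ⊚ q11 = q1 ⊚ b -> d ⊚ q21 = q2 ⊚ c ->
    is_pullback f b a f1 -> is_pullback m c a m1 ->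
    (is_pushout f1 m1 q11 q21 <->
       (is_pullback q1 d b q11 /\ is_pullback q2 d c q21)).

End CatDefs.

Definition adhesive (C : Cat) : Prop :=
  (forall (A B D : C) (f : Hom A D) (g : Hom B D),
      exists (P : C) (p1 : Hom P A) (p2 : Hom P B), is_pullback f g p1 p2) /\
  (forall (A B B' : C) (f : Hom A B) (m : Hom A B'), mono m ->
      exists (Q : C) (q1 : Hom B Q) (q2 : Hom B' Q), is_pushout f m q1 q2) /\
  (forall (A B B' Q : C) (f : Hom A B) (m : Hom A B') (q1 : Hom B Q)
      (q2 : Hom B' Q), mono m -> is_pushout f m q1 q2 -> is_VK f m q1 q2).

Definition is_FPC {C : Cat} {A B C0 D : C} (c : Hom B C0) (a : Hom A B)
    (d : Hom D C0) (b : Hom A D) : Prop :=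
  c ⊚ a = d ⊚ b /\ is_pullback c d a b /\
  forall (E F : C) (x : Hom E B) (y : Hom E F) (z : Hom F C0) (w : Hom E A),
    is_pullback c z x y -> a ⊚ w = x ->
    exists! w' : Hom F D, d ⊚ w' = z /\ w' ⊚ y = b ⊚ w.

Definition all_FPCs_along_monos (C : Cat) : Prop :=
  forall (K I X : C) (i : Hom K I) (m : Hom I X), mono i -> mono m ->
    exists (D : C) (d : Hom D X) (b : Hom K D), is_FPC m i d b.

Definition monos_stable_under_FPCs (C : Cat) : Prop :=
  forall (K I X : C) (i : Hom K I) (m : Hom I X), mono i -> mono m ->
    forall (D : C) (d : Hom D X) (b : Hom K D), is_FPC m i d b ->
      mono d /\ mono b.

Section Rules.
Context {C : Cat}.

(** A rule (O <-o- K -i-> I); linear when both legs are monos.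
    Elements of Lin(C) are represented by linear rules; equality in Lin(C)
    is [rule_iso]. *)
Record Rule := { rO : C; rK : C; rI : C; ro : Hom rK rO; ri : Hom rK rI }.

Definition linear (p : Rule) : Prop := mono (ro p) /\ mono (ri p).

Definition rule_iso (p q : Rule) : Prop :=
  exists (aO : Hom (rO p) (rO q)) (aK : Hom (rK p) (rK q))
         (aI : Hom (rI p) (rI q)),
    is_iso aO /\ is_iso aK /\ is_iso aI /\
    aO ⊚ ro p = ro q ⊚ aK /\ aI ⊚ ri p = ri q ⊚ aK.

(** A span X <-mX- M -mY-> Y (a match of p2 into p1 is a span
    I2 <- M21 -> O1). Spans are identified up to [match_iso]. *)
Record Match (X Y : C) := { mM : C; mX : Hom mM X; mY : Hom mM Y }.

Definition match_iso {X Y : C} (m m' : Match X Y) : Prop :=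
  exists th : Hom (mM m) (mM m'),
    is_iso th /\ mX m' ⊚ th = mX m /\ mY m' ⊚ th = mY m.

Definition match_postX {X X' Y : C} (m : Match X Y) (h : Hom X X') : Match X' Y :=
  {| mM := mM m; mX := h ⊚ mX m; mY := mY m |}.
Definition match_postY {X Y Y' : C} (m : Match X Y) (h : Hom Y Y') : Match X Y' :=
  {| mM := mM m; mX := mX m; mY := h ⊚ mY m |}.

Definition sqpo_admissible (p2 p1 : Rule) (m : Match (rI p2) (rO p1)) : Prop :=
  mono (mX m) /\ mono (mY m) /\
  exists (N : C) (n2 : Hom (rI p2) N) (n1 : Hom (rO p1) N),
    is_pushout (mX m) (mY m) n2 n1 /\
    exists (Kb1 : C) (k1 : Hom (rK p1) Kb1) (o1' : Hom Kb1 N),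
      is_pushout (ro p1) k1 n1 o1'.
Arguments sqpo_admissible p2 p1 m : clear implicits.

Record CompW (p2 p1 : Rule) (m : Match (rI p2) (rO p1)) := {
  wN : C; wn2 : Hom (rI p2) wN; wn1 : Hom (rO p1) wN;
  wKb1 : C; wk1 : Hom (rK p1) wKb1; wo1' : Hom wKb1 wN;
  wKb2 : C; wi2' : Hom wKb2 wN; wk2 : Hom (rK p2) wKb2;
  wO21 : C; woo2 : Hom (rO p2) wO21; wo2' : Hom wKb2 wO21;
  wI21 : C; wii1 : Hom (rI p1) wI21; wi1' : Hom wKb1 wI21;
  wK21 : C; wi2'' : Hom wK21 wKb2; wo1'' : Hom wK21 wKb1;
  w_po : is_pushout (mX m) (mY m) wn2 wn1;
  w_pc : is_pushout (ro p1) wk1 wn1 wo1';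
  w_fpc : is_FPC wn2 (ri p2) wi2' wk2;
  w_poO : is_pushout (ro p2) wk2 woo2 wo2';
  w_poI : is_pushout (ri p1) wk1 wii1 wi1';
  w_pb : is_pullback wi2' wo1' wi2'' wo1''
}.
Arguments CompW p2 p1 m : clear implicits.

Definition comp_rule {p2 p1 : Rule} {m : Match (rI p2) (rO p1)}
    (W : CompW p2 p1 m) : Rule :=
  {| rO := wO21 W; rK := wK21 W; rI := wI21 W;
     ro := wo2' W ⊚ wi2'' W; ri := wi1' W ⊚ wo1'' W |}.

Definition witness_iso {p2 p1 : Rule} {m m' : Match (rI p2) (rO p1)}
    (W : CompW p2 p1 m) (W' : CompW p2 p1 m')
    (aO : Hom (wO21 W) (wO21 W')) (aI : Hom (wI21 W) (wI21 W')) : Prop :=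
  exists (aN : Hom (wN W) (wN W')) (aKb1 : Hom (wKb1 W) (wKb1 W'))
         (aKb2 : Hom (wKb2 W) (wKb2 W')) (aK : Hom (wK21 W) (wK21 W')),
    is_iso aO /\ is_iso aI /\ is_iso aN /\ is_iso aKb1 /\ is_iso aKb2 /\
    is_iso aK /\
    aN ⊚ wn2 W = wn2 W' /\ aN ⊚ wn1 W = wn1 W' /\
    aKb1 ⊚ wk1 W = wk1 W' /\ aN ⊚ wo1' W = wo1' W' ⊚ aKb1 /\
    aKb2 ⊚ wk2 W = wk2 W' /\ aN ⊚ wi2' W = wi2' W' ⊚ aKb2 /\
    aO ⊚ woo2 W = woo2 W' /\ aO ⊚ wo2' W = wo2' W' ⊚ aKb2 /\
    aI ⊚ wii1 W = wii1 W' /\ aI ⊚ wi1' W = wi1' W' ⊚ aKb1 /\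
    aKb2 ⊚ wi2'' W = wi2'' W' ⊚ aK /\ aKb1 ⊚ wo1'' W = wo1'' W' ⊚ aK.
Arguments witness_iso {p2 p1 m m'} W W' aO aI.

Record PairA (p1 p2 p3 : Rule) := {
  a21 : Match (rI p2) (rO p1);
  aW : CompW p2 p1 a21;
  a3 : Match (rI p3) (rO (comp_rule aW));
  a21_adm : sqpo_admissible p2 p1 a21;
  a3_adm : sqpo_admissible p3 (comp_rule aW) a3
}.

Record PairB (p1 p2 p3 : Rule) := {
  b32 : Match (rI p3) (rO p2);
  bW : CompW p3 p2 b32;
  b1 : Match (rI (comp_rule bW)) (rO p1);
  b32_adm : sqpo_admissible p3 p2 b32;
  b1_adm : sqpo_admissible (comp_rule bW) p1 b1
}.

(** Identification of pairs: matches up to iso, with the second match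
    transported along the induced iso of the (chosen) intermediate composite. *)
Definition equivA {p1 p2 p3 : Rule} (x y : PairA p1 p2 p3) : Prop :=
  match_iso (a21 x) (a21 y) /\
  exists aO aI, witness_iso (aW x) (aW y) aO aI /\
    match_iso (match_postY (a3 x) aO) (a3 y).

Definition equivB {p1 p2 p3 : Rule} (x y : PairB p1 p2 p3) : Prop :=
  match_iso (b32 x) (b32 y) /\
  exists aO aI, witness_iso (bW x) (bW y) aO aI /\
    match_iso (match_postX (b1 x) aI) (b1 y).

Definition corr {p1 p2 p3 : Rule} (x : PairA p1 p2 p3) (y : PairB p1 p2 p3) : Prop :=
  forall (Wa : CompW p3 (comp_rule (aW x)) (a3 x))
         (Wb : CompW (comp_rule (bW y)) p1 (b1 y)),
    rule_iso (comp_rule Wa) (comp_rule Wb).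

End Rules.
Arguments Rule C : clear implicits.

(* Main.v *)
(* A morphism x : X -> N is read as a generalized element of N, and a mono
   a : A -> N as the predicate [factors x a]. In an adhesive category a pushout
   of monos presents its corner as a union of two subobjects with given
   intersection, and such a union can be eliminated locally ([po_local]); an FPC
   of monos is an implication between subobjects ([fpc_factors]).

   The two ways of composing three rules are compared through one object P, the
   final pullback complement of K_2 -> I_2 -> N_(32)1 and at the same time the
   complement of the middle rule in N_3(21): one has N_3(21) = O_21 u P with
   intersection Kbar_2, and N_(32)1 = N_21 u P with the same intersection.
   Starting from either pair of matches this rebuilds the other gluing object,
   and the missing matches are the intersections of I_3 with O_2 in N_3(21) and
   of I_32 with O_1 in N_(32)1, or of I_2 with O_1 in N_(32)1 and of I_3 with
   O_21 in N_3(21). Both pairs determine P and hence each other up to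
   isomorphism, and the composites agree because their complements glue along
   the ones of the intermediate composites. *)

Require Import Defs.
From Stdlib Require Import ClassicalEpsilon.
Set Implicit Arguments.
Unset Strict Implicit.

(** * Generalized elements and equational reasoning *)

Section Elements.
Context {C : Cat}.

Lemma precomp {B D : C} {f g : Hom B D} (e : f = g) (X : C) (h : Hom X B) :
  f ⊚ h = g ⊚ h.
Proof. now rewrite e. Qed.

Lemma eq_elements {A B : C} (f g : Hom A B) :
  (forall X (x : Hom X A), f ⊚ x = g ⊚ x) -> f = g.
Proof.
  intro H; rewrite <- (cmp_id_r f), <- (cmp_id_r g); apply H.
Qed.

Definition factors {X A N : C} (x : Hom X N) (a : Hom A N) : Prop :=
  exists x', a ⊚ x' = x.

Lemma po_comm {A B B' Q : C} {f : Hom A B} {g : Hom A B'} {q1 : Hom B Q}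
  {q2 : Hom B' Q} : is_pushout f g q1 q2 -> q1 ⊚ f = q2 ⊚ g.
Proof. intro H; apply H. Qed.

Lemma pb_comm {A B D P : C} {f : Hom A D} {g : Hom B D} {p : Hom P A}
  {q : Hom P B} : is_pullback f g p q -> f ⊚ p = g ⊚ q.
Proof. intro H; apply H. Qed.

Lemma fpc_comm {A B X D : C} {m : Hom B X} {i : Hom A B} {d : Hom D X}
  {b : Hom A D} : is_FPC m i d b -> m ⊚ i = d ⊚ b.
Proof. intro H; apply H. Qed.

End Elements.

Ltac normalize_in K := repeat rewrite <- cmp_assoc in K;
  repeat (rewrite cmp_id_l in K || rewrite cmp_id_r in K).
Ltac normalize := repeat rewrite <- cmp_assoc;
  repeat (rewrite cmp_id_l || rewrite cmp_id_r).

Ltac generalize_eq H :=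
  lazymatch type of H with
  | @eq (@Hom ?C ?A ?B) ?f ?g =>
    let E := fresh "E" in
    eassert (E : forall (X : C) (x : @Hom C X A), _ = _);
    [ let X := fresh in let x := fresh in let K := fresh in
      intros X x; pose proof (precomp H x) as K; normalize_in K; exact K
    | ]; clear H
  end.

(* Equations between composites: composing both sides with a generalized
   element makes every hypothesis a rewrite rule on right-nested words, and
   congruence instantiates the rules. *)
Ltac cat :=
  apply eq_elements; let X := fresh in let x := fresh in intros X x;
  repeat match goal with
    | H : is_pushout ?f ?g ?a ?b |- _ =>
        lazymatch goal with
        | _ : a ⊚ f = b ⊚ g |- _ => fail
        | _ => pose proof (po_comm H)
        end
    | H : is_pullback ?f ?g ?a ?b |- _ =>
        lazymatch goal with
        | _ : f ⊚ a = g ⊚ b |- _ => fail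
        | _ => pose proof (pb_comm H)
        end
    | H : is_FPC ?f ?g ?a ?b |- _ =>
        lazymatch goal with
        | _ : f ⊚ g = a ⊚ b |- _ => fail
        | _ => pose proof (fpc_comm H)
        end
  end;
  repeat match goal with
    | H : @eq (@Hom _ _ _) _ _ |- _ => generalize_eq H
  end;
  normalize; congruence 20000.

Ltac conjs := repeat match goal with |- _ /\ _ => split end.

(** * Pushouts, pullbacks and isomorphisms in an arbitrary category *)

Section Basics.
Context {C : Cat}.
Implicit Types A B D N P Q X : C.

Lemma mono_cmp A B D (f : Hom A B) (g : Hom B D) :
  mono f -> mono g -> mono (g ⊚ f).
Proof.
  intros Hf Hg X x y E. apply Hf, Hg. cat.
Qed.

Lemma mono_cancel A B D (f : Hom A B) (g : Hom B D) :
  mono (g ⊚ f) -> mono f.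
Proof.
  intros H X x y E. apply H. cat.
Qed.

Lemma po_sym A B B' Q (f : Hom A B) (g : Hom A B') (q1 : Hom B Q) (q2 : Hom B' Q) :
  is_pushout f g q1 q2 -> is_pushout g f q2 q1.
Proof.
  intros [E H]; split; [now symmetry|].
  intros X x1 x2 E'. destruct (H X x2 x1 (eq_sym E')) as [u [[? ?] U]].
  exists u; split; [tauto|]. intros v [? ?]; apply U; tauto.
Qed.

Lemma pb_sym A B D P (f : Hom A D) (g : Hom B D) (p : Hom P A) (q : Hom P B) :
  is_pullback f g p q -> is_pullback g f q p.
Proof.
  intros [E H]; split; [now symmetry|].
  intros X x1 x2 E'. destruct (H X x2 x1 (eq_sym E')) as [u [[? ?] U]].
  exists u; split; [tauto|]. intros v [? ?]; apply U; tauto.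
Qed.

Lemma po_ex A B B' Q (f : Hom A B) (g : Hom A B') (q1 : Hom B Q) (q2 : Hom B' Q)
  X (x : Hom B X) (y : Hom B' X) : is_pushout f g q1 q2 -> x ⊚ f = y ⊚ g ->
  exists u, u ⊚ q1 = x /\ u ⊚ q2 = y.
Proof.
  intros [_ H] E. destruct (H X x y E) as [u [? _]]. now exists u.
Qed.

Lemma po_uniq A B B' Q (f : Hom A B) (g : Hom A B') (q1 : Hom B Q) (q2 : Hom B' Q)
  X (u v : Hom Q X) : is_pushout f g q1 q2 ->
  u ⊚ q1 = v ⊚ q1 -> u ⊚ q2 = v ⊚ q2 -> u = v.
Proof.
  intros [E H] E1 E2.
  destruct (H X (v ⊚ q1) (v ⊚ q2)) as [w [_ U]]; [cat|].
  rewrite <- (U u), <- (U v); auto.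
Qed.

Lemma pb_ex A B D P (f : Hom A D) (g : Hom B D) (p : Hom P A) (q : Hom P B)
  X (x : Hom X A) (y : Hom X B) : is_pullback f g p q -> f ⊚ x = g ⊚ y ->
  exists u, p ⊚ u = x /\ q ⊚ u = y.
Proof.
  intros [_ H] E. destruct (H X x y E) as [u [? _]]. now exists u.
Qed.

Lemma pb_uniq A B D P (f : Hom A D) (g : Hom B D) (p : Hom P A) (q : Hom P B)
  X (u v : Hom X P) : is_pullback f g p q ->
  p ⊚ u = p ⊚ v -> q ⊚ u = q ⊚ v -> u = v.
Proof.
  intros [E H] E1 E2.
  destruct (H X (p ⊚ v) (q ⊚ v)) as [w [_ U]]; [cat|].
  rewrite <- (U u), <- (U v); auto.
Qed.

Lemma po_intro A B B' Q (f : Hom A B) (g : Hom A B') (q1 : Hom B Q) (q2 : Hom B' Q) :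
  q1 ⊚ f = q2 ⊚ g ->
  (forall X (x : Hom B X) (y : Hom B' X), x ⊚ f = y ⊚ g ->
    exists u, u ⊚ q1 = x /\ u ⊚ q2 = y) ->
  (forall X (u v : Hom Q X), u ⊚ q1 = v ⊚ q1 -> u ⊚ q2 = v ⊚ q2 -> u = v) ->
  is_pushout f g q1 q2.
Proof.
  intros E H U; split; [exact E|]. intros X x y Exy.
  destruct (H X x y Exy) as [u [E1 E2]]. exists u; split; [easy|].
  intros v [E3 E4]; apply U; congruence.
Qed.

Lemma pb_intro A B D P (f : Hom A D) (g : Hom B D) (p : Hom P A) (q : Hom P B) :
  f ⊚ p = g ⊚ q ->
  (forall X (x : Hom X A) (y : Hom X B), f ⊚ x = g ⊚ y ->
    exists u, p ⊚ u = x /\ q ⊚ u = y) ->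
  (forall X (u v : Hom X P), p ⊚ u = p ⊚ v -> q ⊚ u = q ⊚ v -> u = v) ->
  is_pullback f g p q.
Proof.
  intros E H U; split; [exact E|]. intros X x y Exy.
  destruct (H X x y Exy) as [u [E1 E2]]. exists u; split; [easy|].
  intros v [E3 E4]; apply U; congruence.
Qed.

Lemma pb_mono_r A B D P (f : Hom A D) (g : Hom B D) (p : Hom P A) (q : Hom P B) :
  is_pullback f g p q -> mono f -> mono q.
Proof.
  intros H Hf X x y E. apply (pb_uniq H); [|exact E].
  apply Hf. cat.
Qed.

Lemma pb_mono_l A B D P (f : Hom A D) (g : Hom B D) (p : Hom P A) (q : Hom P B) :
  is_pullback f g p q -> mono g -> mono p.
Proof. intros H Hg. exact (pb_mono_r (pb_sym H) Hg). Qed.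

(** For monos the pullback is an intersection: only the first component has to be lifted, since [g]
    being mono fixes the second. *)
Lemma pb_of_mono A B D P (f : Hom A D) (g : Hom B D) (p : Hom P A) (q : Hom P B) :
  mono f -> mono g -> mono p -> f ⊚ p = g ⊚ q ->
  (forall X (x : Hom X A) (y : Hom X B), f ⊚ x = g ⊚ y -> factors x p) ->
  is_pullback f g p q.
Proof.
  intros Hf Hg Hp E H. apply pb_intro; [exact E| |].
  - intros X x y Exy. destruct (H X x y Exy) as [u Eu]. exists u; split; [exact Eu|].
    apply Hg. cat.
  - intros X u v Eu _. now apply Hp.
Qed.

Lemma po_paste A B A' B1 A'' B2 (f : Hom A B) (g : Hom A A') (q1 : Hom B B1)
  (q2 : Hom A' B1) (g' : Hom A' A'') (r1 : Hom B1 B2) (r2 : Hom A'' B2) :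
  is_pushout f g q1 q2 -> is_pushout q2 g' r1 r2 ->
  is_pushout f (g' ⊚ g) (r1 ⊚ q1) r2.
Proof.
  intros H1 H2. apply po_intro; [cat| |].
  - intros X x y E.
    destruct (po_ex (x := x) (y := (y ⊚ g')) H1) as [u [E1 E2]]; [cat|].
    destruct (po_ex H2 E2) as [v [E3 E4]]. exists v; split; [cat|exact E4].
  - intros X u v E1 E2. apply (po_uniq H2); [|exact E2].
    apply (po_uniq H1); cat.
Qed.

Lemma po_cancel A B A' B1 A'' B2 (f : Hom A B) (g : Hom A A') (q1 : Hom B B1)
  (q2 : Hom A' B1) (g' : Hom A' A'') (r1 : Hom B1 B2) (r2 : Hom A'' B2) :
  is_pushout f g q1 q2 -> is_pushout f (g' ⊚ g) (r1 ⊚ q1) r2 ->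
  r1 ⊚ q2 = r2 ⊚ g' -> is_pushout q2 g' r1 r2.
Proof.
  intros H1 H2 E. apply po_intro; [cat| |].
  - intros X x y E1.
    destruct (po_ex (x := (x ⊚ q1)) (y := y) H2) as [u [E2 E3]]; [cat|].
    exists u; split; [|exact E3]. apply (po_uniq H1); cat.
  - intros X u v E1 E2. apply (po_uniq H2); cat.
Qed.

Lemma inverse_square A B A2 B2 (f : Hom A B) (f' : Hom A2 B2) (a : Hom A A2)
  (ai : Hom A2 A) (b : Hom B B2) (bi : Hom B2 B) :
  b ⊚ f = f' ⊚ a -> a ⊚ ai = idm A2 -> bi ⊚ b = idm B -> bi ⊚ f' = f ⊚ ai.
Proof.
  intros E E1 E2. rewrite <- (cmp_id_r f'), <- E1. cat.
Qed.

Lemma po_iso A B B' Q A2 B2 B2' Q2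
  (f : Hom A B) (g : Hom A B') (q1 : Hom B Q) (q2 : Hom B' Q)
  (f' : Hom A2 B2) (g' : Hom A2 B2') (q1' : Hom B2 Q2) (q2' : Hom B2' Q2)
  (a : Hom A A2) (b : Hom B B2) (c : Hom B' B2') :
  is_pushout f g q1 q2 -> is_pushout f' g' q1' q2' ->
  is_iso a -> is_iso b -> is_iso c -> b ⊚ f = f' ⊚ a -> c ⊚ g = g' ⊚ a ->
  exists d, is_iso d /\ d ⊚ q1 = q1' ⊚ b /\ d ⊚ q2 = q2' ⊚ c.
Proof.
  intros H H' [ai [a1 a2]] [bi [b1 b2]] [ci [c1 c2]] Ef Eg.
  destruct (po_ex (x := (q1' ⊚ b)) (y := (q2' ⊚ c)) H) as [d [d1 d2]]; [cat|].
  pose proof (inverse_square Ef a2 b1) as Ef'.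
  pose proof (inverse_square Eg a2 c1) as Eg'.
  destruct (po_ex (x := (q1 ⊚ bi)) (y := (q2 ⊚ ci)) H') as [e [e1 e2]]; [cat|].
  exists d; split; [|easy]. exists e; split.
  - apply (po_uniq H); cat.
  - apply (po_uniq H'); cat.
Qed.

Lemma pb_iso A B D P A2 B2 D2 P2
  (f : Hom A D) (g : Hom B D) (p : Hom P A) (q : Hom P B)
  (f' : Hom A2 D2) (g' : Hom B2 D2) (p' : Hom P2 A2) (q' : Hom P2 B2)
  (a : Hom A A2) (b : Hom B B2) (d : Hom D D2) :
  is_pullback f g p q -> is_pullback f' g' p' q' ->
  is_iso a -> is_iso b -> is_iso d -> d ⊚ f = f' ⊚ a -> d ⊚ g = g' ⊚ b ->
  exists c, is_iso c /\ p' ⊚ c = a ⊚ p /\ q' ⊚ c = b ⊚ q.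
Proof.
  intros H H' [ai [a1 a2]] [bi [b1 b2]] [di [d1 d2]] Ef Eg.
  destruct (pb_ex (x := (a ⊚ p)) (y := (b ⊚ q)) H') as [c [c1 c2]]; [cat|].
  pose proof (inverse_square Ef a2 d1) as Ef'.
  pose proof (inverse_square Eg b2 d1) as Eg'.
  destruct (pb_ex (x := (ai ⊚ p')) (y := (bi ⊚ q')) H) as [e [e1 e2]]; [cat|].
  exists c; split; [|easy]. exists e; split.
  - apply (pb_uniq H); cat.
  - apply (pb_uniq H'); cat.
Qed.

Lemma iso_id A : is_iso (idm A).
Proof. exists (idm A); now rewrite cmp_id_l. Qed.

Lemma iso_mono A B (f : Hom A B) : is_iso f -> mono f.
Proof. 
  intros [g [E _]] X x y H.
  rewrite <- (cmp_id_l x), <- (cmp_id_l y), <- E. cat.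
 Qed.

End Basics.

(** * Pushouts along monos and final pullback complements in an adhesive category *)

Section Adhesive.
Context {C : Cat} (HC : adhesive C).
Implicit Types A B D N P Q X S T : C.

Lemma ex_pb A B D (f : Hom A D) (g : Hom B D) :
  exists P (p : Hom P A) (q : Hom P B), is_pullback f g p q.
Proof. apply HC. Qed.

Lemma ex_po A B B' (f : Hom A B) (m : Hom A B') : mono m ->
  exists Q (q1 : Hom B Q) (q2 : Hom B' Q), is_pushout f m q1 q2.
Proof. apply HC. Qed.

Lemma po_VK A B B' Q (f : Hom A B) (m : Hom A B') (q1 : Hom B Q) (q2 : Hom B' Q) :
  mono m -> is_pushout f m q1 q2 -> is_VK f m q1 q2.
Proof. apply HC. Qed.

(* The cube over the square with identities on B and the degenerate top face
   A -> B, A = A. *)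
Lemma po_mono_pb A B B' Q (f : Hom A B) (m : Hom A B') (q1 : Hom B Q)
  (q2 : Hom B' Q) : mono m -> is_pushout f m q1 q2 ->
  mono q1 /\ is_pullback q1 q2 f m.
Proof.
  intros Hm H. destruct (po_VK Hm H) as [_ V].
  destruct (V A B A B (idm A) (idm B) m q1 f (idm A) (idm B) f) as [V1 _];
    try solve [cat].
  - apply pb_intro; [cat| |].
    + intros X x y E. exists x. split; cat.
    + intros X u v E _. cat.
  - apply pb_of_mono; try assumption; try (apply iso_mono, iso_id); [cat|].
    intros X x y E. exists x. cat.
  - destruct V1 as [V1 V2].
    + apply po_intro; [cat| |].
      * intros X x y E. exists x. split; cat.
      * intros X u v E _. cat.
    + split; [|now apply pb_sym].
      intros X x y E. destruct (pb_ex V1 E) as [u [? ?]]. cat.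
Qed.

(** The van Kampen property, read from the pullback faces to the pushout on top. Of the front faces
    the conclusion keeps commutativity, which is what the case distinctions below use. *)
Lemma po_stable A B B' Q (f : Hom A B) (m : Hom A B') (q1 : Hom B Q)
  (q2 : Hom B' Q) X (x : Hom X Q) : mono m -> is_pushout f m q1 q2 ->
  exists A1 B1 B1' (b : Hom B1 B) (b' : Hom B1' B') (f1 : Hom A1 B1)
    (m1 : Hom A1 B1') (x1 : Hom B1 X) (x2 : Hom B1' X),
    is_pushout f1 m1 x1 x2 /\ q1 ⊚ b = x ⊚ x1 /\ q2 ⊚ b' = x ⊚ x2.
Proof.
  intros Hm H. destruct (po_VK Hm H) as [_ V].
  destruct (ex_pb q1 x) as [B1 [b [x1 P1]]].
  destruct (ex_pb q2 x) as [B1' [b' [x2 P2]]].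
  destruct (ex_pb f b) as [A1 [a [f1 P3]]].
  destruct (pb_ex (x := (m ⊚ a)) (y := (x1 ⊚ f1)) P2) as [m1 [E1 E2]]; [cat|].
  exists A1, B1, B1', b, b', f1, m1, x1, x2.
  split; [|split; [apply P1|apply P2]].
  refine (proj2 (V _ _ _ _ a b b' x f1 m1 x1 x2 _ _ _ _ _ P3 _) (conj P1 P2)); try solve [cat].
  (* The back face over [m] is a pullback because its paste with [P2] agrees with the paste of [P3]
     and [P1]. *)
  apply pb_intro; [cat| |].
  - intros Y y z E.
    destruct (pb_ex (x := (f ⊚ y)) (y := (x2 ⊚ z)) P1) as [v [E3 E4]]; [cat|].
    destruct (pb_ex (x := y) (y := v) P3) as [w [E5 E6]]; [cat|].
    exists w. split; [exact E5|]. apply (pb_uniq P2); cat.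
  - intros Y u v E3 E4. apply (pb_uniq P3); [exact E3|]. apply (pb_uniq P1); cat.
Qed.

(** Pulled back along [x], the pushout presents [X] as glued from its parts over [B] and over [B'],
    so these parts are jointly epic. *)
Lemma po_local_eq A B B' Q (f : Hom A B) (m : Hom A B') (q1 : Hom B Q)
  (q2 : Hom B' Q) X T (x : Hom X Q) (t t' : Hom X T) :
  mono m -> is_pushout f m q1 q2 ->
  (forall Y (y : Hom Y X) (z : Hom Y B), q1 ⊚ z = x ⊚ y -> t ⊚ y = t' ⊚ y) ->
  (forall Y (y : Hom Y X) (z : Hom Y B'), q2 ⊚ z = x ⊚ y -> t ⊚ y = t' ⊚ y) ->
  t = t'.
Proof.
  intros Hm H H1 H2.
  destruct (po_stable x Hm H) as (A1 & B1 & B1' & b & b' & f1 & m1 & x1 & x2 & P & E1 & E2).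
  apply (po_uniq P); eauto.
Qed.

(** Elimination of a union by cases. The lifts found over the two parts agree on the overlap because
    [s] is mono, so they glue. The element [x] on which the cases are split may differ from the
    element [t] to be lifted. *)
Lemma po_local A B B' Q (f : Hom A B) (m : Hom A B') (q1 : Hom B Q)
  (q2 : Hom B' Q) X S T (x : Hom X Q) (t : Hom X T) (s : Hom S T) :
  mono m -> is_pushout f m q1 q2 -> mono s ->
  (forall Y (y : Hom Y X) (z : Hom Y B), q1 ⊚ z = x ⊚ y -> factors (t ⊚ y) s) ->
  (forall Y (y : Hom Y X) (z : Hom Y B'), q2 ⊚ z = x ⊚ y -> factors (t ⊚ y) s) ->
  factors t s.
Proof.
  intros Hm H Hs H1 H2.
  destruct (po_stable x Hm H) as (A1 & B1 & B1' & b & b' & f1 & m1 & x1 & x2 & P & E1 & E2).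
  destruct (H1 _ _ _ E1) as [t1 Et1]. destruct (H2 _ _ _ E2) as [t2 Et2].
  destruct (po_ex (x := t1) (y := t2) P) as [u [Eu1 Eu2]].
  - apply Hs. cat.
  - exists u. apply (po_uniq P); cat.
Qed.

(** Two elements of [Q] with the same image are compared locally: on the same side because [a] or
    [b] is mono, on opposite sides because both then come from one element of the intersection
    [P]. *)
Lemma union_mono A B P N Q (a : Hom A N) (b : Hom B N) (p : Hom P A) (q : Hom P B)
  (q1 : Hom A Q) (q2 : Hom B Q) (s : Hom Q N) :
  mono a -> mono b -> is_pullback a b p q -> is_pushout p q q1 q2 ->
  s ⊚ q1 = a -> s ⊚ q2 = b -> mono s.
Proof.
  intros Ha Hb H1 H2 Ea Eb X x x' E.
  assert (Hq : mono q) by exact (pb_mono_r H1 Ha).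
  apply (po_local_eq Hq H2 (x := x)); intros Y y z Ez;
  apply (po_local_eq Hq H2 (x := x' ⊚ y)); intros Z w v Ev.
  - assert (z ⊚ w = v) by (apply Ha; cat). cat.
  - destruct (pb_ex (x := (z ⊚ w)) (y := v) H1) as [u [? ?]]; cat.
  - destruct (pb_ex (x := v) (y := (z ⊚ w)) H1) as [u [? ?]]; cat.
  - assert (z ⊚ w = v) by (apply Hb; cat). cat.
Qed.

(** The abstract pushout [Q] embeds in [N] by [union_mono], and the covering hypothesis gives this
    mono a section, so it is invertible. *)
Lemma po_of_cover A B P N (a : Hom A N) (b : Hom B N) (p : Hom P A) (q : Hom P B) :
  mono a -> mono b -> is_pullback a b p q ->
  (forall S (s : Hom S N), mono s -> factors a s -> factors b s ->
    factors (idm N) s) ->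
  is_pushout p q a b.
Proof.
  intros Ha Hb H Hcov.
  destruct (ex_po p (pb_mono_r H Ha)) as [Q [q1 [q2 HQ]]].
  destruct (po_ex HQ (pb_comm H)) as [s [Es1 Es2]].
  assert (Hs : mono s) by exact (union_mono Ha Hb H HQ Es1 Es2).
  destruct (Hcov _ s Hs) as [r Er]; [now exists q1|now exists q2|].
  assert (Er' : r ⊚ s = idm Q) by (apply Hs; cat).
  apply po_intro; [apply H| |].
  - intros X x y E. destruct (po_ex HQ E) as [u [E1 E2]].
    exists (u ⊚ r). split; cat.
  - intros X u v E1 E2.
    assert (u ⊚ s = v ⊚ s) by (apply (po_uniq HQ); cat).
    rewrite <- (cmp_id_r u), <- (cmp_id_r v), <- Er. cat.
Qed.

Lemma po_mono_l A B B' Q (f : Hom A B) (m : Hom A B') (q1 : Hom B Q)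
  (q2 : Hom B' Q) : mono m -> is_pushout f m q1 q2 -> mono q1.
Proof. intros Hm H. apply (po_mono_pb Hm H). Qed.

Lemma po_mono_r A B B' Q (f : Hom A B) (m : Hom A B') (q1 : Hom B Q)
  (q2 : Hom B' Q) : mono f -> is_pushout f m q1 q2 -> mono q2.
Proof. intros Hf H. exact (po_mono_l Hf (po_sym H)). Qed.

Lemma po_pb A B B' Q (f : Hom A B) (m : Hom A B') (q1 : Hom B Q)
  (q2 : Hom B' Q) : mono m -> is_pushout f m q1 q2 -> is_pullback q1 q2 f m.
Proof. intros Hm H. apply (po_mono_pb Hm H). Qed.

Lemma fpc_pb K I X D (m : Hom I X) (i : Hom K I) (d : Hom D X) (b : Hom K D) :
  is_FPC m i d b -> is_pullback m d i b.
Proof. intro H; apply H. Qed.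

(** Introduction rule for the implication from [m] to [i]: the universal property of the FPC applied
    to the pullback of [z] along [m]. *)
Lemma fpc_factors K I X D (m : Hom I X) (i : Hom K I) (d : Hom D X) (b : Hom K D)
  Z (z : Hom Z X) : is_FPC m i d b ->
  (forall Y (y : Hom Y Z) (x : Hom Y I), m ⊚ x = z ⊚ y -> factors x i) ->
  factors z d.
Proof.
  intros (_ & _ & H) Hz. destruct (ex_pb m z) as [E [x [y P]]].
  destruct (Hz _ y x (pb_comm P)) as [w Ew].
  destruct (H _ _ _ _ _ w P Ew) as [z' [[? _] _]]. now exists z'.
Qed.

(** The last two hypotheses are the elimination and introduction rules of the implication;
    uniqueness of the lifts comes from [d] being mono. *)
Lemma fpc_intro K I X D (m : Hom I X) (i : Hom K I) (d : Hom D X) (b : Hom K D) :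
  mono m -> mono i -> mono d -> m ⊚ i = d ⊚ b ->
  (forall Y (y : Hom Y D) (x : Hom Y I), m ⊚ x = d ⊚ y -> factors x i) ->
  (forall Z (z : Hom Z X),
    (forall Y (y : Hom Y Z) (x : Hom Y I), m ⊚ x = z ⊚ y -> factors x i) ->
    factors z d) ->
  is_FPC m i d b.
Proof.
  intros Hm Hi Hd E H1 H2. repeat split; [exact E|exact E| |].
  - apply pb_of_mono; auto. intros Y x y. apply H1.
  - intros Y Z x y z w P Ew. destruct (H2 _ z) as [z' Ez].
    + intros Y' y' x' E'. destruct (pb_ex P E') as [u [Eu _]].
      exists (w ⊚ u). cat.
    + exists z'. repeat split; [exact Ez| |].
      * apply Hd. cat.
      * intros v [Ev _]. apply Hd. congruence.
Qed.

(** Split an element of [Q]: its part in [B] lies in [A] by assumption, hence in [B'], and the rest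
    is in [B'] anyway. Pushout complements thereby share the introduction rule and the uniqueness of
    FPCs. *)
Lemma po_fpc A B B' Q (f : Hom A B) (m : Hom A B') (q1 : Hom B Q) (q2 : Hom B' Q) :
  mono f -> mono m -> is_pushout f m q1 q2 -> is_FPC q1 f q2 m.
Proof.
  intros Hf Hm H. pose proof (po_pb Hm H) as Hpb.
  pose proof (po_mono_l Hm H) as Hq1. pose proof (po_mono_r Hf H) as Hq2.
  apply fpc_intro; auto; [apply H| |].
  - intros Y y x E. destruct (pb_ex Hpb E) as [u [? _]]. now exists u.
  - intros Z z Hz. apply (po_local (x := z) Hm H Hq2).
    + intros Y y x E. destruct (Hz _ _ _ E) as [u Eu].
      exists (m ⊚ u). cat.
    + intros Y y x E. now exists x.
Qed.

(** Implications chain: an element lies in [p] when its part in [N] lies in [d], that is, when the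
    part of that part in [I] lies in [i]. *)
Lemma fpc_paste K I D N P S (i : Hom K I) (m : Hom I N) (d : Hom D N) (b : Hom K D)
  (n : Hom N S) (p : Hom P S) (u : Hom D P) :
  mono m -> mono i -> mono n -> mono p ->
  is_FPC m i d b -> is_FPC n d p u -> is_FPC (n ⊚ m) i p (u ⊚ b).
Proof.
  intros Hm Hi Hn Hp F G. apply fpc_intro; auto using mono_cmp; [cat| |].
  - intros Y y x E.
    destruct (pb_ex (x := m ⊚ x) (y := y) (fpc_pb G)) as (q & E1 & E2); [cat|].
    destruct (pb_ex (x := x) (y := q) (fpc_pb F)) as (r & E3 & E4); [cat|].
    now exists r.
  - intros Z z Hz. apply (fpc_factors G). intros Y y x E.
    apply (fpc_factors F). intros Y' y' x' E'.
    apply (Hz _ (y ⊚ y')). cat.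
Qed.

Lemma fpc_map K I X D K' I' X' D'
  (m : Hom I X) (i : Hom K I) (d : Hom D X) (b : Hom K D)
  (m' : Hom I' X') (i' : Hom K' I') (d' : Hom D' X') (b' : Hom K' D')
  (k : Hom K K') (h : Hom I I') (h' : Hom I' I) (x : Hom X X') (x' : Hom X' X) :
  is_FPC m i d b -> is_FPC m' i' d' b' ->
  h ⊚ i = i' ⊚ k -> h ⊚ h' = idm I' -> x ⊚ m = m' ⊚ h -> x' ⊚ x = idm X ->
  h' ⊚ h = idm I -> factors (x ⊚ d) d'.
Proof.
  intros H H' E1 E2 E3 E4 E5. apply (fpc_factors H'). intros Y y z E.
  pose proof (inverse_square E3 E2 E4) as E6.
  destruct (pb_ex (x := (h' ⊚ z)) (y := y) (fpc_pb H)) as [u [Eu _]].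
  { rewrite <- (cmp_id_l (d ⊚ y)), <- E4. cat. }
  exists (k ⊚ u). rewrite <- (cmp_id_l z), <- E2. cat.
Qed.

Lemma fpc_iso K I X D K' I' X' D'
  (m : Hom I X) (i : Hom K I) (d : Hom D X) (b : Hom K D)
  (m' : Hom I' X') (i' : Hom K' I') (d' : Hom D' X') (b' : Hom K' D')
  (k : Hom K K') (h : Hom I I') (x : Hom X X') :
  mono d -> mono d' ->
  is_FPC m i d b -> is_FPC m' i' d' b' -> is_iso k -> is_iso h -> is_iso x ->
  h ⊚ i = i' ⊚ k -> x ⊚ m = m' ⊚ h ->
  exists e, is_iso e /\ d' ⊚ e = x ⊚ d /\ e ⊚ b = b' ⊚ k.
Proof.
  intros Hd Hd' H H' [k' [k1 k2]] [h' [h1 h2]] [x' [x1 x2]] E1 E2.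
  destruct (fpc_map H H' E1 h2 E2 x1 h1) as [e Ee].
  destruct (fpc_map H' H (inverse_square E1 k2 h1) h1 (inverse_square E2 h2 x1) x2 h2)
    as [e' Ee'].
  exists e. split; [|split; [exact Ee|apply Hd'; cat]].
  exists e'. split.
  - apply Hd. rewrite cmp_id_r, <- (cmp_id_l d), <- x1. cat.
  - apply Hd'. rewrite cmp_id_r, <- (cmp_id_l d'), <- x2. cat.
Qed.

(** * Composites of linear rules, their existence and uniqueness *)

Context (Hfpc : all_FPCs_along_monos C) (Hstab : monos_stable_under_FPCs C).

Lemma fpc_mono K I X D (m : Hom I X) (i : Hom K I) (d : Hom D X) (b : Hom K D) :
  mono m -> mono i -> is_FPC m i d b -> mono d /\ mono b.
Proof. intros Hm Hi H. exact (Hstab Hi Hm H). Qed.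

Definition mono_match X Y (m : Match X Y) : Prop := mono (mX m) /\ mono (mY m).

Lemma comp_monos (p1 p2 : Rule C) (m : Match (rI p2) (rO p1))
  (W : CompW m) : linear p1 -> linear p2 -> mono_match m ->
  (mono (wn2 W) /\ mono (wn1 W)) /\ (mono (wk1 W) /\ mono (wo1' W)) /\
  (mono (wi2' W) /\ mono (wk2 W)) /\ (mono (woo2 W) /\ mono (wo2' W)) /\
  (mono (wii1 W) /\ mono (wi1' W)) /\ (mono (wi2'' W) /\ mono (wo1'' W)).
Proof.
  intros [Ho1 Hi1] [Ho2 Hi2] [HX HY]; destruct W; cbn in *.
  assert (mono wn1) by exact (po_mono_r HX w_po).
  assert (mono wn2) by exact (po_mono_l HY w_po).
  assert (mono wo1') by exact (po_mono_r Ho1 w_pc).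
  assert (mono wk1).
  { apply (mono_cancel (g := wo1')). rewrite <- (po_comm w_pc). now apply mono_cmp. }
  destruct (fpc_mono H0 Hi2 w_fpc).
  repeat split; try assumption.
  - exact (po_mono_l H4 w_poO).
  - exact (po_mono_r Ho2 w_poO).
  - exact (po_mono_l H2 w_poI).
  - exact (po_mono_r Hi1 w_poI).
  - exact (pb_mono_l w_pb H1).
  - exact (pb_mono_r w_pb H3).
Qed.

Lemma comp_linear (p1 p2 : Rule C) (m : Match (rI p2) (rO p1)) (W : CompW m) :
  linear p1 -> linear p2 -> mono_match m -> linear (comp_rule W).
Proof.
  intros H1 H2 Hm.
  destruct (comp_monos W H1 H2 Hm) as (_ & _ & _ & [_ ?] & [_ ?] & [? ?]).
  split; now apply mono_cmp.
Qed.

Lemma comp_iso (p1 p2 : Rule C) (m m' : Match (rI p2) (rO p1))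
  (W : CompW m) (W' : CompW m') : linear p1 -> linear p2 ->
  mono_match m -> mono_match m' -> match_iso m m' ->
  exists (aO : Hom (wO21 W) (wO21 W')) (aI : Hom (wI21 W) (wI21 W')),
    witness_iso aO aI.
Proof.
  intros H1 H2 Hm Hm' (th & Hth & EX & EY).
  destruct (comp_monos W H1 H2 Hm) as ([? ?] & [? ?] & [? ?] & _).
  destruct (comp_monos W' H1 H2 Hm') as ([? ?] & [? ?] & [? ?] & _).
  destruct H1 as [Ho1 Hi1], H2 as [Ho2 Hi2]; destruct W as [N n2 n1 Kb1 k1 o1 Kb2 i2 k2
    O21 oo2 o2 I21 ii1 i1 K21 kl kr po pc fpc poO poI pb],
    W' as [N' n2' n1' Kb1' k1' o1' Kb2' i2' k2'
    O21' oo2' o2' I21' ii1' i1' K21' kl' kr' po' pc' fpc' poO' poI' pb']; cbn in *.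
  destruct (po_iso (b := idm _) (c := idm _) po po' Hth (iso_id _) (iso_id _))
    as (aN & HaN & N1 & N2); [cat|cat|].
  (* The pushout complement is unique up to isomorphism because, by [po_fpc], it is an FPC. *)
  destruct (fpc_iso (k := idm _) (h := idm _) (x := aN) H4 H10 (po_fpc Ho1 H3 pc)
    (po_fpc Ho1 H9 pc') (iso_id _) (iso_id _) HaN) as (aKb1 & HaKb1 & B1 & B2); [cat|cat|].
  destruct (fpc_iso (k := idm _) (h := idm _) (x := aN) H5 H11 fpc
    fpc' (iso_id _) (iso_id _) HaN) as (aKb2 & HaKb2 & B3 & B4); [cat|cat|].
  destruct (po_iso (b := idm _) (c := aKb2) poO poO' (iso_id _) (iso_id _) HaKb2)
    as (aO & HaO & O1 & O2); [cat|cat|].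
  destruct (po_iso (b := idm _) (c := aKb1) poI poI' (iso_id _) (iso_id _) HaKb1)
    as (aI & HaI & I1 & I2); [cat|cat|].
  destruct (pb_iso (a := aKb2) (b := aKb1) (d := aN) pb pb' HaKb2 HaKb1 HaN)
    as (aK & HaK & K1 & K2); [cat|cat|].
  rewrite cmp_id_r in N1, N2, B2, B4, O1, I1.
  exists aO, aI, aN, aKb1, aKb2, aK; cbn. repeat split; auto.
Qed.

Lemma ex_comp (p1 p2 : Rule C) N Kb1 (n2 : Hom (rI p2) N) (n1 : Hom (rO p1) N)
  (k1 : Hom (rK p1) Kb1) (o1 : Hom Kb1 N) :
  linear p1 -> linear p2 -> mono n1 -> mono n2 -> is_pushout (ro p1) k1 n1 o1 ->
  exists Kb2 (i2 : Hom Kb2 N) (k2 : Hom (rK p2) Kb2)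
    O21 (oo2 : Hom (rO p2) O21) (o2 : Hom Kb2 O21)
    I21 (ii1 : Hom (rI p1) I21) (i1 : Hom Kb1 I21)
    K21 (kl : Hom K21 Kb2) (kr : Hom K21 Kb1),
    is_FPC n2 (ri p2) i2 k2 /\ is_pushout (ro p2) k2 oo2 o2 /\
    is_pushout (ri p1) k1 ii1 i1 /\ is_pullback i2 o1 kl kr.
Proof.
  intros [Ho1 Hi1] [Ho2 Hi2] Hn1 Hn2 H.
  destruct (Hfpc Hi2 Hn2) as (Kb2 & i2 & k2 & fpc).
  destruct (fpc_mono Hn2 Hi2 fpc) as [Hi2' Hk2].
  destruct (ex_po (ro p2) Hk2) as (O21 & oo2 & o2 & poO).
  assert (Hk1 : mono k1).
  { apply (mono_cancel (g := o1)). rewrite <- (po_comm H). now apply mono_cmp. }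
  destruct (ex_po (ri p1) Hk1) as (I21 & ii1 & i1 & poI).
  destruct (ex_pb i2 o1) as (K21 & kl & kr & pb).
  exists Kb2, i2, k2, O21, oo2, o2, I21, ii1, i1, K21, kl, kr. auto.
Qed.

Lemma comp_admissible (p1 p2 : Rule C) (m : Match (rI p2) (rO p1)) (W : CompW m) :
  mono_match m -> sqpo_admissible m.
Proof.
  intros [? ?]; destruct W. repeat split; try assumption.
  exists wN, wn2, wn1. split; [assumption|]. now exists wKb1, wk1, wo1'.
Qed.

Lemma adm_mono (p1 p2 : Rule C) (m : Match (rI p2) (rO p1)) :
  sqpo_admissible m -> mono_match m.
Proof. intros (? & ? & _). now split. Qed.

(** * The relation between the two kinds of pairs, and its totality on both sides *)

Context (p1 p2 p3 : Rule C).
Context (H1 : linear p1) (H2 : linear p2) (H3 : linear p3).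
Implicit Types (x : PairA p1 p2 p3) (y : PairB p1 p2 p3).

(* [T] and [S] are N_3(21) and N_(32)1. Proofs below write [N], [V] for N_21,
   N_32; [Kb2] is the complement of the middle rule in N_21 and [Lb2] the one
   in N_32; [P] contains both. *)
Definition bridge x y T S (t3 : Hom (rI p3) T) (t21 : Hom (wO21 (aW x)) T)
  (s32 : Hom (wI21 (bW y)) S) (s1 : Hom (rO p1) S) : Prop :=
  exists P (u : Hom (wKb2 (aW x)) P) (w : Hom (wKb1 (bW y)) P)
    (pT : Hom P T) (pS : Hom P S) (nS : Hom (wN (aW x)) S) (vT : Hom (wN (bW y)) T),
    (is_pushout (mX (a3 x)) (mY (a3 x)) t3 t21 /\
     is_pushout (mX (b1 y)) (mY (b1 y)) s32 s1) /\
    (mono u /\ mono w) /\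
    (is_pushout (wo2' (aW x)) u t21 pT /\ is_pushout (wi2' (aW x)) u nS pS /\
     is_pushout (wo1' (bW y)) w vT pT) /\
    (nS ⊚ wn2 (aW x) = s32 ⊚ wii1 (bW y) /\ nS ⊚ wn1 (aW x) = s1 /\
     vT ⊚ wn2 (bW y) = t3 /\ vT ⊚ wn1 (bW y) = t21 ⊚ woo2 (aW x) /\
     u ⊚ wk2 (aW x) = w ⊚ wk1 (bW y) /\ s32 ⊚ wi1' (bW y) = pS ⊚ w).

Definition related x y : Prop :=
  exists T S t3 t21 s32 s1, @bridge x y T S t3 t21 s32 s1.

Lemma related_left_total x : exists y, related x y.
Proof.
  destruct x as [m W m3 adm adm3].
  pose proof (adm_mono adm) as Hm. pose proof (adm_mono adm3) as [HX3 HY3].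
  destruct (comp_monos W H1 H2 Hm) as
   ([Hn2 Hn1] & [Hk1 Ho1'] & [Hi2' Hk2] & [Hoo2 Ho2'] & [Hii1 Hi1'] & [Hkl Hkr]).
  pose proof adm3 as (_ & _ & T & t3 & t21 & poT & Kb21 & kb & o & pcT).
  destruct W as [N n2 n1 Kb1 k1 o1 Kb2 i2 k2
    O21 oo2 o2 I21 ii1 i1 K21 kl kr po pc fpc poO poI pb]; cbn in *.
  assert (Ht3 : mono t3) by exact (po_mono_l HY3 poT).
  assert (Ht21 : mono t21) by exact (po_mono_r HX3 poT).
  assert (Ho : mono o) by exact (po_mono_r (mono_cmp Hkl Ho2') pcT).
  assert (Hkb : mono kb).
  { apply (mono_cancel (g := o)). rewrite <- (po_comm pcT).
    apply mono_cmp; [now apply mono_cmp|exact Ht21]. }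
  (* [P] is glued from the complements [Kb2] in [N] and [Kb21] in [T] along [K21]. *)
  destruct (ex_po kl Hkb) as (P & u & g & poP).
  assert (Hu : mono u) by exact (po_mono_l Hkb poP).
  assert (Hg : mono g) by exact (po_mono_r Hkl poP).
  destruct (po_ex (x := t21 ⊚ o2) (y := o) poP) as (pT & E1 & E2); [cat|].
  assert (B3 : is_pushout o2 u t21 pT).
  (* [T] is [O21] and [Kb21] glued along [K21]. As [K21] enters [O21] through [Kb2], gluing [Kb21]
     to [Kb2] first gives [T] as [O21] and [P] glued along [Kb2]. *)
  { apply po_sym. apply (po_cancel (po_sym poP)); [|cat].
    rewrite E2. exact (po_sym pcT). }
  assert (HpT : mono pT) by exact (po_mono_r Ho2' B3).
  destruct (ex_po i2 Hu) as (S & nS & pS & B4).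
  assert (HnS : mono nS) by exact (po_mono_l Hu B4).
  assert (HpS : mono pS) by exact (po_mono_r Hi2' B4).
  assert (pb3 := po_pb Hu B3). assert (pb4 := po_pb Hu B4).
  destruct (ex_pb t3 (t21 ⊚ oo2)) as (M32 & m32X & m32Y & pbM).
  assert (Ht : mono (t21 ⊚ oo2)) by now apply mono_cmp.
  assert (HmX := pb_mono_l pbM Ht). assert (HmY := pb_mono_r pbM Ht3).
  destruct (ex_po m32X HmY) as (V & v3 & v2 & poV).
  destruct (po_ex poV (pb_comm pbM)) as (vT & E3 & E4).
  assert (HvT : mono vT) by exact (union_mono Ht3 Ht pbM poV E3 E4).
  assert (Hv3 : mono v3) by exact (po_mono_l HmY poV).
  assert (Hv2 : mono v2) by exact (po_mono_r HmX poV).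
  (* The complement of the middle rule in [V] is the intersection of [V] with [P]. *)
  destruct (ex_pb vT pT) as (Lb2 & lo & w & pbL).
  assert (Hlo : mono lo) by exact (pb_mono_l pbL HpT).
  assert (Hw : mono w) by exact (pb_mono_r pbL HvT).
  destruct (pb_ex (x := v2 ⊚ ro p2) (y := u ⊚ k2) pbL) as (l2 & E5 & E6); [cat|].
  destruct H1 as [Hro1 Hri1], H2 as [Hro2 Hri2], H3 as [Hro3 Hri3].
  assert (pcV : is_pushout (ro p2) l2 v2 lo).
  (* O_2 meets [P] inside [Kb2], hence in K_2. For covering, an element of [V] is traced in [T],
     where it falls in O_2, in [Kb2] or in [P]; the last two cases put it in [Lb2]. *)
  { apply po_of_cover; auto.
    - apply pb_of_mono; auto; [cat..|]. intros X x y E.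
      destruct (pb_ex (x := oo2 ⊚ x) (y := w ⊚ y) pb3) as (z & E7 & E8); [cat|].
      destruct (pb_ex (x := x) (y := z) (po_pb Hk2 poO)) as (q & E9 & E10); [cat|].
      now exists q.
    - intros Z s Hs [s1 F1] [s2 F2].
      apply (po_local (x := vT) Hu B3 Hs); intros Y y z E.
      + apply (po_local (x := z) Hk2 poO Hs); intros Y' y' z' E'.
        * exists (s1 ⊚ z'). apply HvT. cat.
        * destruct (pb_ex (x := y ⊚ y') (y := u ⊚ z') pbL) as (q & E7 & E8); [cat|].
          exists (s2 ⊚ q). cat.
      + destruct (pb_ex (x := y) (y := z) pbL) as (q & E7 & E8); [cat|].
        exists (s2 ⊚ q). cat. }
  assert (B5 : is_pushout lo w vT pT).
  { apply po_of_cover; auto.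
    intros Z s Hs [s1 F1] [s2 F2].
    apply (po_local (x := idm T) Hu B3 Hs); intros Y y z E; [|exists (s2 ⊚ z); cat].
    apply (po_local (x := z) Hk2 poO Hs); intros Y' y' z' E'.
    - exists (s1 ⊚ v2 ⊚ z'). cat.
    - exists (s2 ⊚ u ⊚ z'). cat. }
  destruct (@ex_comp p2 p3 V Lb2 v3 v2 l2 lo) as (Lb3 & li3 & l3 & O32 & oo3 & o3 &
    I32 & e2 & e & K32 & kl3 & kr3 & fpcV & poO3 & poI2 & pbK); auto; try now split.
  assert (Hl2 : mono l2).
  { apply (mono_cancel (g := w)). rewrite E6. now apply mono_cmp. }
  destruct (po_ex (x := nS ⊚ n2) (y := pS ⊚ w) poI2) as (s32 & E7 & E8); [cat|].
  assert (Hs32 : mono s32).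
  { apply (union_mono (a := nS ⊚ n2) (b := pS ⊚ w) (p := ri p2) (q := l2)
      (q1 := e2) (q2 := e)); auto using mono_cmp.
    (* I_2 and [Lb2] meet in [S] in K_2, because [N] and [P] meet in [Kb2] and I_2 meets [Kb2] in
       K_2. *)
    apply pb_of_mono; auto using mono_cmp; [cat..|]. intros X x y E.
    destruct (pb_ex (x := n2 ⊚ x) (y := w ⊚ y) pb4) as (z & E9 & E10); [cat|].
    destruct (pb_ex (x := x) (y := z) (fpc_pb fpc)) as (q & E11 & E12); [cat|].
    now exists q. }
  destruct (ex_pb s32 (nS ⊚ n1)) as (M & b1X & b1Y & pbM1).
  assert (Hs1 : mono (nS ⊚ n1)) by now apply mono_cmp.
  assert (Hm' := adm_mono adm). destruct Hm' as [HmX21 HmY21].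
  assert (B2 : is_pushout b1X b1Y s32 (nS ⊚ n1)).
  (* The part of [S] in [N] is covered by I_2 and O_1. The part in [P] is split in [T]: its elements
     in I_3 lie in [Lb2], those in [O21] lie in [Kb2] and so in [N]. *)
  { apply po_of_cover; auto.
    intros Z s Hs [s1 F1] [s2 F2].
    assert (HN : forall Y (y : Hom Y S) (z : Hom Y N), nS ⊚ z = y -> factors y s).
    { intros Y y z E. apply (po_local (x := z) HmY21 po Hs); intros Y' y' z' E'.
      - exists (s1 ⊚ e2 ⊚ z'). cat.
      - exists (s2 ⊚ z'). cat. }
    apply (po_local (x := idm S) Hu B4 Hs); intros Y y z E.
    - apply (HN _ _ z). cat.
    - apply (po_local (x := pT ⊚ z) HY3 poT Hs); intros Y' y' z' E'.
      + destruct (pb_ex (x := v3 ⊚ z') (y := z ⊚ y') pbL) as (q & E9 & E10); [cat|].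
        exists (s1 ⊚ e ⊚ q). cat.
      + destruct (pb_ex (x := z') (y := z ⊚ y') pb3) as (q & E9 & E10); [cat|].
        apply (HN _ _ (i2 ⊚ q)). cat. }
  (* The complement of [p1] in [S] is [Kb1] extended by [Kb21] along [K21]: since [P] is [Kb2]
     extended by [Kb21], extending [N] by [P] amounts to extending it by [Kb21]. *)
  destruct (ex_po kr Hkb) as (Kb1' & c & h & poK).
  destruct (po_ex (x := nS ⊚ o1) (y := pS ⊚ g) poK) as (d & E9 & E10); [cat|].
  assert (pcS : is_pushout (ro p1) (c ⊚ k1) (nS ⊚ n1) d).
  { apply (po_paste pc). apply po_sym, (po_cancel (po_sym poK)); [|cat].
    rewrite E10, <- (pb_comm pb). exact (po_paste (po_sym poP) (po_sym B4)). }
  pose (m32 := {| mX := m32X; mY := m32Y |} : Match (rI p3) (rO p2)).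
  pose (W' := @Build_CompW C p3 p2 m32 _ _ _ _ _ _ _ _ _ _ _ _ _ _ _ _ _ _
    poV pcV fpcV poO3 poI2 pbK).
  pose (m1 := {| mX := b1X; mY := b1Y |} : Match (rI (comp_rule W')) (rO p1)).
  assert (admV : sqpo_admissible m32) by (apply (comp_admissible W'); now split).
  assert (adm1 : sqpo_admissible m1).
  { repeat split; [exact (pb_mono_l pbM1 Hs1)|exact (pb_mono_r pbM1 Hs32)|].
    cbn. exists S, s32, (nS ⊚ n1). split; [exact B2|]. now exists Kb1', (c ⊚ k1), d. }
  exists (Build_PairB admV adm1), T, S, t3, t21, s32, (nS ⊚ n1).
  exists P, u, w, pT, pS, nS, vT; cbn.
  conjs; auto.
Qed.

Lemma related_right_total y : exists x, related x y.
Proof.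
  destruct y as [m W m1 adm adm1].
  pose proof (adm_mono adm) as Hm. pose proof (adm_mono adm1) as [HX1 HY1].
  destruct (comp_monos W H2 H3 Hm) as
   ([Hv3 Hv2] & [Hl2 Hlo] & [Hli3 Hl3] & [Hoo3 Ho3] & [He2 He] & [Hkl3 Hkr3]).
  pose proof adm1 as (_ & _ & S & s32 & s1 & poS & Kb1' & k1' & d1' & pcS).
  destruct W as [V v3 v2 Lb2 l2 lo Lb3 li3 l3
    O32 oo3 o3 I32 e2 e K32 kl3 kr3 poV pcV fpcV poO3 poI2 pbK]; cbn in *.
  destruct H1 as [Hro1 Hri1], H2 as [Hro2 Hri2], H3 as [Hro3 Hri3].
  assert (Hs32 : mono s32) by exact (po_mono_l HY1 poS).
  assert (Hs1 : mono s1) by exact (po_mono_r HX1 poS).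
  assert (Hd1 : mono d1') by exact (po_mono_r Hro1 pcS).
  assert (Hk1' : mono k1').
  { apply (mono_cancel (g := d1')). rewrite <- (po_comm pcS). now apply mono_cmp. }
  assert (Hse : mono (s32 ⊚ e2)) by now apply mono_cmp.
  (* [T] is not yet available, so [P] is formed in [S], as the implication from I_2 to K_2. *)
  destruct (Hfpc Hri2 Hse) as (P & pS & kp & fpcP).
  destruct (fpc_mono Hse Hri2 fpcP) as [HpS Hkp].
  assert (pbI := po_pb Hl2 poI2).
  destruct (fpc_factors (z := s32 ⊚ e) fpcP) as [w Ew].
  { intros Y y x E.
    assert (E' : e2 ⊚ x = e ⊚ y) by (apply Hs32; cat).
    destruct (pb_ex pbI E') as (q & Eq & _). now exists q. }
  assert (Hw : mono w).
  { apply (mono_cancel (g := pS)). rewrite Ew. now apply mono_cmp. }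
  (* [N] becomes the union of I_2 and O_1 inside [S], and [Kb1] the part of [Kb1'] in [N]. *)
  destruct (ex_pb (s32 ⊚ e2) s1) as (M21 & mX21 & mY21 & pbM).
  assert (HmX := pb_mono_l pbM Hs1). assert (HmY := pb_mono_r pbM Hse).
  destruct (ex_po mX21 HmY) as (N & n2 & n1 & poN).
  destruct (po_ex poN (pb_comm pbM)) as (nS & E3 & E4).
  assert (HnS : mono nS) by exact (union_mono Hse Hs1 pbM poN E3 E4).
  assert (Hn2 : mono n2) by exact (po_mono_l HmY poN).
  assert (Hn1 : mono n1) by exact (po_mono_r HmX poN).
  destruct (ex_pb nS d1') as (Kb1 & o1 & c & pbK1).
  assert (Ho1 : mono o1) by exact (pb_mono_l pbK1 Hd1).
  assert (Hc : mono c) by exact (pb_mono_r pbK1 HnS).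
  destruct (pb_ex (x := n1 ⊚ ro p1) (y := k1') pbK1) as (k1 & E5 & E6); [cat|].
  assert (Hk1 : mono k1).
  { apply (mono_cancel (g := c)). now rewrite E6. }
  assert (pbS1 := po_pb Hk1' pcS).
  assert (pcN : is_pushout (ro p1) k1 n1 o1).
  { apply po_of_cover; auto.
    - apply pb_of_mono; auto; [cat..|]. intros X x y E.
      destruct (pb_ex (x := x) (y := c ⊚ y) pbS1) as (q & E7 & E8); [cat|].
      now exists q.
    - intros Z s Hs [s2 F1] [s3 F2].
      apply (po_local (x := nS) Hk1' pcS Hs); intros Y y z E.
      + exists (s2 ⊚ z). apply HnS. cat.
      + destruct (pb_ex (x := y) (y := z) pbK1) as (q & E7 & E8); [cat|].
        exists (s3 ⊚ q). cat. }
  destruct (ex_comp (p1 := p1) (p2 := p2) H1 H2 Hn1 Hn2 pcN) as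
    (Kb2 & i2 & k2 & O21 & oo2 & o2 & I21 & ii1 & i1 & K21 & kl & kr & fpcN & poO & poI & pbK21).
  destruct (fpc_mono Hn2 Hri2 fpcN) as [Hi2 Hk2].
  destruct (fpc_factors (z := nS ⊚ i2) fpcP) as [u Eu].
  { intros Y y x E.
    destruct (pb_ex (x := x) (y := y) (fpc_pb fpcN)) as (q & Eq & _); [apply HnS; cat|].
    now exists q. }
  assert (Hu : mono u).
  { apply (mono_cancel (g := pS)). rewrite Eu. now apply mono_cmp. }
  assert (pbKb2 : is_pullback nS pS i2 u).
  (* Implication restricts to [N], so [Kb2] is the part of [P] in [N]. *)
  { apply pb_of_mono; auto. intros X x y E. apply (fpc_factors fpcN).
    intros Y y' z E'.
    destruct (pb_ex (x := z) (y := y ⊚ y') (fpc_pb fpcP)) as (q & Eq & _); [cat|].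
    now exists q. }
  assert (Ekp : u ⊚ k2 = kp) by (apply HpS; cat).
  assert (Ekp' : w ⊚ l2 = kp) by (apply HpS; cat).
  assert (B4 : is_pushout i2 u nS pS).
  (* [S] is covered by I_2, [Lb2] and O_1; the second lies in [P] and the others in [N]. *)
  { apply po_of_cover; auto. intros Z s Hs [s2 F1] [s3 F2].
    apply (po_local (x := idm S) HY1 poS Hs); intros Y y z E.
    - apply (po_local (x := z) Hl2 poI2 Hs); intros Y' y' z' E'.
      + exists (s2 ⊚ n2 ⊚ z'). cat.
      + exists (s3 ⊚ w ⊚ z'). cat.
    - exists (s2 ⊚ n1 ⊚ z). cat. }
  assert (Hoo2 : mono oo2) by exact (po_mono_l Hk2 poO).
  assert (Ho2 : mono o2) by exact (po_mono_r Hro2 poO).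
  destruct (ex_po o2 Hu) as (T & t21 & pT & B3).
  assert (Ht21 : mono t21) by exact (po_mono_l Hu B3).
  assert (HpT : mono pT) by exact (po_mono_r Ho2 B3).
  assert (pb3 := po_pb Hu B3).
  assert (pbO := po_pb Hk2 poO).
  destruct (po_ex (x := t21 ⊚ oo2) (y := pT ⊚ w) pcV) as (vT & E9 & E10); [cat|].
  (* In [T], O_2 meets [P] in K_2; this makes [vT] mono and [Lb2] the intersection of [V] with
     [P]. *)
  assert (Hmid : forall X (x : Hom X (rO p2)) (y : Hom X P), t21 ⊚ oo2 ⊚ x = pT ⊚ y ->
     exists q, ro p2 ⊚ q = x /\ kp ⊚ q = y).
  { intros X x y E.
    destruct (pb_ex (x := oo2 ⊚ x) (y := y) pb3) as (z & F1 & F2); [cat|].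
    destruct (pb_ex (x := x) (y := z) pbO) as (q & F3 & F4); [cat|].
    exists q. split; [exact F3|]. cat. }
  assert (HvT : mono vT).
  { apply (union_mono (a := t21 ⊚ oo2) (b := pT ⊚ w) (p := ro p2) (q := l2)
      (q1 := v2) (q2 := lo)); auto using mono_cmp.
    apply pb_of_mono; auto using mono_cmp; [cat..|]. intros X x y E.
    destruct (Hmid X x (w ⊚ y)) as (q & F1 & F2); [cat|]. now exists q. }
  assert (pbL : is_pullback vT pT lo w).
  { apply pb_of_mono; auto. intros X x y E.
    apply (po_local (x := x) Hl2 pcV Hlo); intros Y y' z E'.
    - destruct (Hmid Y z (y ⊚ y')) as (q & F1 & F2); [cat|].
      exists (l2 ⊚ q). cat.
    - exists z. exact E'. }
  assert (B5 : is_pushout lo w vT pT).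
  { apply po_of_cover; auto. intros Z s Hs [s2 F1] [s3 F2].
    apply (po_local (x := idm T) Hu B3 Hs); intros Y y z E.
    - apply (po_local (x := z) Hk2 poO Hs); intros Y' y' z' E'.
      + exists (s2 ⊚ v2 ⊚ z'). cat.
      + exists (s3 ⊚ u ⊚ z'). cat.
    - exists (s3 ⊚ z). cat. }
  destruct (ex_pb (vT ⊚ v3) t21) as (M3 & m3X & m3Y & pbM3).
  assert (Ht3 : mono (vT ⊚ v3)) by now apply mono_cmp.
  destruct (adm_mono adm) as [HmX32 HmY32].
  assert (B1 : is_pushout m3X m3Y (vT ⊚ v3) t21).
  (* An element of [P] is split in [S]: in I_2 it lies in K_2 and in O_1 it lies in [Kb2], both
     inside [O21]; in [Lb2] it lies in [V], hence in I_3 or O_2. *)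
  { apply po_of_cover; auto. intros Z s Hs [s2 F1] [s3 F2].
    apply (po_local (x := idm T) Hu B3 Hs); intros Y y z E; [exists (s3 ⊚ z); cat|].
    apply (po_local (x := pS ⊚ z) HY1 poS Hs); intros Y' y' z' E'.
    - apply (po_local (x := z') Hl2 poI2 Hs); intros Y'' y'' z'' E''.
      + destruct (pb_ex (x := z'') (y := z ⊚ y' ⊚ y'') (fpc_pb fpcP)) as (q & F3 & F4); [cat|].
        exists (s3 ⊚ o2 ⊚ k2 ⊚ q). cat.
      + assert (F3 : z ⊚ y' ⊚ y'' = w ⊚ z'') by (apply HpS; cat).
        apply (po_local (x := lo ⊚ z'') HmY32 poV Hs); intros X x x' F4.
        * exists (s2 ⊚ x'). cat.
        * exists (s3 ⊚ oo2 ⊚ x'). cat.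
    - destruct (pb_ex (x := n1 ⊚ z') (y := z ⊚ y') pbKb2) as (q & F3 & F4); [cat|].
      exists (s3 ⊚ o2 ⊚ q). cat. }
  (* The complement of the composite rule in [T] is the intersection of [P] with [Kb1'], formed in
     [S]. *)
  destruct (ex_pb pS d1') as (Kb21 & g & h & pbKb21).
  assert (Hg : mono g) by exact (pb_mono_l pbKb21 Hd1).
  destruct (pb_ex (x := u ⊚ kl) (y := c ⊚ kr) pbKb21) as (kb & F1 & F2); [cat|].
  assert (Hkl : mono kl) by exact (pb_mono_l pbK21 Ho1).
  assert (poP : is_pushout kl kb u g).
  { apply po_of_cover; auto.
    - apply pb_of_mono; auto; [cat..|]. intros X x y E.
      destruct (pb_ex (x := i2 ⊚ x) (y := h ⊚ y) pbK1) as (q & F3 & F4); [cat|].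
      destruct (pb_ex (x := x) (y := q) pbK21) as (r & F5 & F6); [cat|].
      now exists r.
    - intros Z s Hs [s2 G1] [s3 G2].
      apply (po_local (x := pS) Hk1' pcS Hs); intros Y y z E.
      + destruct (pb_ex (x := n1 ⊚ z) (y := y) pbKb2) as (q & F3 & F4); [cat|].
        exists (s2 ⊚ q). cat.
      + destruct (pb_ex (x := y) (y := z) pbKb21) as (q & F3 & F4); [cat|].
        exists (s3 ⊚ q). cat. }
  pose (m21 := {| mX := mX21; mY := mY21 |} : Match (rI p2) (rO p1)).
  pose (W' := @Build_CompW C p2 p1 m21 _ _ _ _ _ _ _ _ _ _ _ _ _ _ _ _ _ _
    poN pcN fpcN poO poI pbK21).
  pose (m3 := {| mX := m3X; mY := m3Y |} : Match (rI p3) (rO (comp_rule W'))).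
  assert (admN : sqpo_admissible m21) by (apply (comp_admissible W'); now split).
  assert (adm3 : sqpo_admissible m3).
  { repeat split; [exact (pb_mono_l pbM3 Ht21)|exact (pb_mono_r pbM3 Ht3)|].
    cbn. exists T, (vT ⊚ v3), t21. split; [exact B1|].
    exists Kb21, kb, (pT ⊚ g). exact (po_sym (po_paste (po_sym poP) (po_sym B3))). }
  exists (Build_PairA admN adm3), T, S, (vT ⊚ v3), t21, s32, s1.
  exists P, u, w, pT, pS, nS, vT; cbn. conjs; auto. cat.
Qed.

(** * Uniqueness of related pairs up to isomorphism *)

Lemma pb_factor A B D T P' (f : Hom A D) (g : Hom B D) (p : Hom P' A) (q : Hom P' B)
  (s : Hom D T) : mono s -> is_pullback f g p q ->
  is_pullback (s ⊚ f) (s ⊚ g) p q.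
Proof.
  intros Hs H. apply pb_intro; [cat| |].
  - intros X x y E. apply (pb_ex H). apply Hs. cat.
  - intros X u v. apply (pb_uniq H).
Qed.

(** The isomorphisms propagate from [T] to its complement [P] and then to [S]. The matches of [y]
    are intersections in [T] and [S], so they are carried along. *)
Lemma related_left_unique x x' y y' :
  related x y -> related x' y' -> equivA x x' -> equivB y y'.
Proof.
  intros R R' (_ & aO & aI & Wiso & th & Hth & EX & EY).
  destruct R as (T & S & t3 & t21 & s32 & s1 & P & u & w & pT & pS & nS & vT &
    [B1 B2] & [Hu Hw] & (B3 & B4 & B5) & (E1 & E2 & E3 & E4 & E5 & E6)).
  destruct R' as (T' & S' & t3' & t21' & s32' & s1' & P' & u' & w' & pT' & pS' & nS' & vT' &
    [B1' B2'] & [Hu' Hw'] & (B3' & B4' & B5') & (E1' & E2' & E3' & E4' & E5' & E6')).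
  destruct Wiso as (aN & aKb1 & aKb2 & aK & HaO & HaI & HaN & HaKb1 & HaKb2 & HaK &
    F1 & F2 & F3 & F4 & F5 & F6 & F7 & F8 & F9 & F10 & F11 & F12).
  pose proof (adm_mono (b32_adm y)) as Hm. pose proof (adm_mono (b32_adm y')) as Hm'.
  pose proof (adm_mono (b1_adm y)) as Hm1. pose proof (adm_mono (b1_adm y')) as Hm1'.
  destruct (comp_monos (aW x) H1 H2 (adm_mono (a21_adm x))) as
   (_ & _ & [Hi2 _] & [_ Ho2] & _).
  destruct (comp_monos (aW x') H1 H2 (adm_mono (a21_adm x'))) as
   (_ & _ & [Hi2' _] & [_ Ho2'] & _).
  destruct (comp_monos (bW y) H2 H3 Hm) as ([Hv3 Hv2] & [_ Hlo] & _).
  destruct (comp_monos (bW y') H2 H3 Hm') as ([Hv3' Hv2'] & [_ Hlo'] & _).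
  cbn in *.
  assert (HpT := po_mono_r Ho2 B3). assert (HpT' := po_mono_r Ho2' B3').
  assert (HvT := po_mono_l Hw B5). assert (HvT' := po_mono_l Hw' B5').
  destruct (po_iso (b := idm _) (c := aO) B1 B1' Hth (iso_id _) HaO)
    as (aT & HaT & G1 & G2); [cat|cat|].
  destruct (fpc_iso (k := aKb2) (h := aO) (x := aT) HpT HpT' (po_fpc Ho2 Hu B3)
    (po_fpc Ho2' Hu' B3') HaKb2 HaO HaT) as (aP & HaP & G3 & G4); [cat|cat|].
  destruct (po_iso (b := aN) (c := aP) B4 B4' HaKb2 HaN HaP)
    as (aS & HaS & G5 & G6); [cat|cat|].
  assert (pbM := pb_factor HvT (po_pb (proj2 Hm) (w_po (bW y)))).
  assert (pbM' := pb_factor HvT' (po_pb (proj2 Hm') (w_po (bW y')))).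
  destruct (pb_iso (a := idm _) (b := idm _) (d := aT) pbM pbM' (iso_id _) (iso_id _) HaT)
    as (th2 & Hth2 & G7 & G8); [cat|cat|].
  rewrite cmp_id_l in G7, G8.
  assert (Hmm : match_iso (b32 y) (b32 y')) by now exists th2.
  split; [exact Hmm|].
  destruct (comp_iso (bW y) (bW y') H2 H3 Hm Hm' Hmm) as (bO & bI & Viso).
  exists bO, bI. split; [exact Viso|].
  destruct Viso as (bV & bLb2 & bLb3 & bK & HbO & HbI & HbV & HbLb2 & HbLb3 & HbK &
    I1 & I2 & I3 & I4 & I5 & I6 & I7 & I8 & I9 & I10 & I11 & I12).
  (* [bI] was obtained from the composition diagrams alone; [J3] shows that it agrees with [aS], so
     the second match is transported along it. *)
  assert (J1 : vT' ⊚ bV = aT ⊚ vT) by (apply (po_uniq (w_po (bW y))); cat).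
  assert (J2 : w' ⊚ bLb2 = aP ⊚ w) by (apply HpT'; cat).
  assert (J3 : s32' ⊚ bI = aS ⊚ s32) by (apply (po_uniq (w_poI (bW y))); cat).
  destruct (pb_iso (a := bI) (b := idm _) (d := aS) (po_pb (proj2 Hm1) B2)
    (po_pb (proj2 Hm1') B2') HbI (iso_id _) HaS)
    as (th1 & Hth1 & G9 & G10); [cat|cat|].
  rewrite cmp_id_l in G10. now exists th1.
Qed.

(** I_32 is covered by I_2 and [Lb2]. An element of I_2 in [P] lies in [Kb2], where N_21 and [P]
    meet, hence in K_2 and so in [Lb2]. *)
Lemma bridge_pb x y S
  (s32 : Hom (wI21 (bW y)) S) (s1 : Hom (rO p1) S) P (pS : Hom P S)
  (u : Hom (wKb2 (aW x)) P) (w : Hom (wKb1 (bW y)) P) (nS : Hom (wN (aW x)) S) :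
  is_pushout (mX (b1 y)) (mY (b1 y)) s32 s1 ->
  mono u -> is_pushout (wi2' (aW x)) u nS pS ->
  nS ⊚ wn2 (aW x) = s32 ⊚ wii1 (bW y) -> u ⊚ wk2 (aW x) = w ⊚ wk1 (bW y) ->
  s32 ⊚ wi1' (bW y) = pS ⊚ w ->
  is_pullback s32 pS (wi1' (bW y)) w.
Proof.
  intros B2 Hu B4 E1 E2 E3.
  destruct (comp_monos (aW x) H1 H2 (adm_mono (a21_adm x))) as (_ & _ & [Hi2 _] & _).
  destruct (comp_monos (bW y) H2 H3 (adm_mono (b32_adm y))) as
    (_ & [Hl2 _] & _ & _ & [_ He] & _).
  destruct (adm_mono (b1_adm y)) as [HX HY].
  apply pb_of_mono; auto.
  - exact (po_mono_l HY B2).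
  - exact (po_mono_r Hi2 B4).
  - intros X z v E. apply (po_local (x := z) Hl2 (w_poI (bW y)) He); intros Y z' v' E'.
    + destruct (pb_ex (x := wn2 (aW x) ⊚ v') (y := v ⊚ z') (po_pb Hu B4))
        as (q & F1 & F2); [cat|].
      destruct (pb_ex (x := v') (y := q) (fpc_pb (w_fpc (aW x)))) as (r & F3 & F4); [cat|].
      exists (wk1 (bW y) ⊚ r).
      transitivity (wii1 (bW y) ⊚ v'); [|exact E'].
      rewrite <- F3. pose proof (w_poI (bW y)). cat.
    + exists v'. exact E'.
Qed.

(** Here [S] comes first, then N_21 as a union in [S], [P] as the complement in [S] belonging to
    [Kb2] in N_21, and finally [T] as N_32 and [P] glued along [Lb2]. *)
Lemma related_right_unique x x' y y' :
  related x y -> related x' y' -> equivB y y' -> equivA x x'.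
Proof.
  intros R R' (_ & bO & bI & Viso & th & Hth & EX & EY).
  destruct R as (T & S & t3 & t21 & s32 & s1 & P & u & w & pT & pS & nS & vT &
    [B1 B2] & [Hu Hw] & (B3 & B4 & B5) & (E1 & E2 & E3 & E4 & E5 & E6)).
  destruct R' as (T' & S' & t3' & t21' & s32' & s1' & P' & u' & w' & pT' & pS' & nS' & vT' &
    [B1' B2'] & [Hu' Hw'] & (B3' & B4' & B5') & (E1' & E2' & E3' & E4' & E5' & E6')).
  destruct Viso as (bV & bLb2 & bLb3 & bK & HbO & HbI & HbV & HbLb2 & HbLb3 & HbK &
    F1 & F2 & F3 & F4 & F5 & F6 & F7 & F8 & F9 & F10 & F11 & F12).
  pose proof (adm_mono (a21_adm x)) as Hm. pose proof (adm_mono (a21_adm x')) as Hm'.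
  pose proof (adm_mono (a3_adm x)) as Hm3. pose proof (adm_mono (a3_adm x')) as Hm3'.
  destruct (comp_monos (aW x) H1 H2 Hm) as
   ([Hn2 Hn1] & _ & [Hi2 _] & [_ Ho2] & _).
  destruct (comp_monos (aW x') H1 H2 Hm') as
   ([Hn2' Hn1'] & _ & [Hi2' _] & [_ Ho2'] & _).
  destruct (comp_monos (bW y) H2 H3 (adm_mono (b32_adm y))) as (_ & [_ Hlo] & _).
  destruct (comp_monos (bW y') H2 H3 (adm_mono (b32_adm y'))) as (_ & [_ Hlo'] & _).
  cbn in *.
  assert (HpS := po_mono_r Hi2 B4). assert (HpS' := po_mono_r Hi2' B4').
  assert (HnS := po_mono_l Hu B4). assert (HnS' := po_mono_l Hu' B4').
  destruct (po_iso (b := bI) (c := idm _) B2 B2' Hth HbI (iso_id _))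
    as (aS & HaS & G1 & G2); [cat|cat|].
  assert (pbM := pb_factor HnS (po_pb (proj2 Hm) (w_po (aW x)))).
  assert (pbM' := pb_factor HnS' (po_pb (proj2 Hm') (w_po (aW x')))).
  destruct (pb_iso (a := idm _) (b := idm _) (d := aS) pbM pbM' (iso_id _) (iso_id _) HaS)
    as (th2 & Hth2 & G7 & G8); [cat|cat|].
  rewrite cmp_id_l in G7, G8.
  assert (Hmm : match_iso (a21 x) (a21 x')) by now exists th2.
  split; [exact Hmm|].
  destruct (comp_iso (aW x) (aW x') H1 H2 Hm Hm' Hmm) as (aO & aI & Wiso).
  exists aO, aI. split; [exact Wiso|].
  destruct Wiso as (aN & aKb1 & aKb2 & aK & HaO & HaI & HaN & HaKb1 & HaKb2 & HaK &
    I1 & I2 & I3 & I4 & I5 & I6 & I7 & I8 & I9 & I10 & I11 & I12).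
  assert (J1 : nS' ⊚ aN = aS ⊚ nS) by (apply (po_uniq (w_po (aW x))); cat).
  destruct (fpc_iso (k := aKb2) (h := aN) (x := aS) HpS HpS' (po_fpc Hi2 Hu B4)
    (po_fpc Hi2' Hu' B4') HaKb2 HaN HaS) as (aP & HaP & G3 & G4); [cat|cat|].
  assert (J2 : aP ⊚ w = w' ⊚ bLb2) by (apply HpS'; cat).
  destruct (po_iso (b := bV) (c := aP) B5 B5' HbLb2 HbV HaP)
    as (aT & HaT & G5 & G6); [cat|cat|].
  assert (J3 : t21' ⊚ aO = aT ⊚ t21) by (apply (po_uniq (w_poO (aW x))); cat).
  destruct (pb_iso (a := idm _) (b := aO) (d := aT) (po_pb (proj2 Hm3) B1)
    (po_pb (proj2 Hm3') B1') (iso_id _) HaO HaT)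
    as (th1 & Hth1 & G9 & G10); [cat|cat|].
  rewrite cmp_id_l in G9. now exists th1.
Qed.

(** * Agreement of the composites *)

Lemma po_postiso A B B' Q Q' (f : Hom A B) (g : Hom A B') (q1 : Hom B Q)
  (q2 : Hom B' Q) (s : Hom Q Q') : is_iso s -> is_pushout f g q1 q2 ->
  is_pushout f g (s ⊚ q1) (s ⊚ q2).
Proof.
  intros (r & E1 & E2) H. apply po_intro; [cat| |].
  - intros X x y E. destruct (po_ex H E) as (u & F1 & F2).
    exists (u ⊚ r). split; cat.
  - intros X u v F1 F2. assert (E : u ⊚ s = v ⊚ s) by (apply (po_uniq H); cat).
    rewrite <- (cmp_id_r u), <- (cmp_id_r v), <- E2. cat.
Qed.

(** [corr] quantifies over all composition diagrams while [related] provides one choice of [T] and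
    [S]; by uniqueness of pushouts the bridge moves to the corners of the given diagrams. *)
Lemma related_bridge x y (Wa : CompW (a3 x)) (Wb : CompW (b1 y)) :
  related x y -> bridge (wn2 Wa) (wn1 Wa) (wn2 Wb) (wn1 Wb).
Proof.
  intros (T & S & t3 & t21 & s32 & s1 & P & u & w & pT & pS & nS & vT &
    [B1 B2] & Huw & (B3 & B4 & B5) & (E1 & E2 & E3 & E4 & E5 & E6)).
  destruct (po_iso (a := idm _) (b := idm _) (c := idm _) B1 (w_po Wa)
    (iso_id _) (iso_id _) (iso_id _)) as (aT & HaT & G1 & G2);
    [now rewrite cmp_id_l, cmp_id_r..|].
  destruct (po_iso (a := idm _) (b := idm _) (c := idm _) B2 (w_po Wb)
    (iso_id _) (iso_id _) (iso_id _)) as (aS & HaS & G3 & G4);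
    [now rewrite cmp_id_l, cmp_id_r..|].
  rewrite cmp_id_r in G1, G2, G3, G4.
  exists P, u, w, (aT ⊚ pT), (aS ⊚ pS), (aS ⊚ nS), (aT ⊚ vT).
  rewrite <- G1, <- G2, <- G3, <- G4.
  split; [split|split; [exact Huw|split; [conjs|conjs]]];
    try (apply po_postiso; assumption); try exact E5; cbn in *; cat.
Qed.

Lemma related_corr x y : related x y -> corr x y.
Proof.
  intros R Wa Wb.
  destruct (related_bridge Wa Wb R) as (P & u & w & pT & pS & nS & vT &
    _ & [Hu Hw] & (B3 & B4 & B5) & (E1 & E2 & E3 & E4 & E5 & E6)).
  assert (pbL := bridge_pb (w_po Wb) Hu B4 E1 E5 E6).
  clear R. destruct x as [m21 W m3 adm21 adm3], y as [m32 W' m1 adm32 adm1]; cbn in *.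
  pose proof (adm_mono adm21) as Hm21. pose proof (adm_mono adm3) as Hm3.
  pose proof (adm_mono adm32) as Hm32. pose proof (adm_mono adm1) as Hm1.
  destruct (comp_monos W H1 H2 Hm21) as
   ([Hn2 Hn1] & [Hk1 Ho1] & [Hi2 Hk2] & [Hoo2 Ho2] & [Hii1 Hi1] & [Hkl Hkr]).
  destruct (comp_monos W' H2 H3 Hm32) as
   ([Hv3 Hv2] & [Hl2 Hlo] & [Hli3 Hl3] & [Hoo3 Ho3] & [He2 He] & [Hkl3 Hkr3]).
  destruct (comp_monos Wa (comp_linear W H1 H2 Hm21) H3 Hm3) as
   ([Ht3 Ht21] & [Hkb Ho] & [Hd3 Hk3] & [Hooa Hoa] & [Hiia Hia] & [Hal Hbe]).
  destruct (comp_monos Wb H1 (comp_linear W' H2 H3 Hm32) Hm1) as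
   ([Hs32 Hs1] & [Hk1' Hd1] & [Hd2 Hk2'] & [Hoob Hob] & [Hiib Hib] & [Hal' Hbe']).
  destruct H1 as [Hro1 Hri1], H2 as [Hro2 Hri2], H3 as [Hro3 Hri3].
  destruct W as [N n2 n1 Kb1 k1 o1 Kb2 i2 k2
    O21 oo2 o2 I21 ii1 i1 K21 kl kr po pc fpc poO poI pb].
  destruct W' as [V v3 v2 Lb2 l2 lo Lb3 li3 l3
    O32 oo3 o3 I32 e2 e K32 kl3 kr3 poV pcV fpcV poO3 poI2 pbK].
  destruct Wa as [T t3 t21 Kb21 kb o Kb3 d3 k3
    Oa ooa oa Ia iia ia Ka al be poT pcT fpcT poOa poIa pba].
  destruct Wb as [S s32 s1 Kb1' k1' d1 Kb32 d2 k2'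
    Ob oob ob Ib iib ib Kbb al' be' poS pcS fpcS poOb poIb pbb].
  cbn in *. clear adm21 adm3 adm32 adm1.
  assert (HpT := po_mono_r Ho2 B3). assert (HpS := po_mono_r Hi2 B4).
  assert (HnS := po_mono_l Hu B4). assert (HvT := po_mono_l Hw B5).
  assert (pb3 := po_pb Hu B3). assert (pb4 := po_pb Hu B4). assert (pb5 := po_pb Hw B5).
  assert (pbo := po_pb Hkb pcT). assert (pbd := po_pb Hk1' pcS).
  assert (pbn := po_pb Hk1 pc).
  (* [Kb21] lies in [P] because its part in [O21] lies in [K21], hence in [Kb2]. *)
  destruct (fpc_factors (z := o) (po_fpc Ho2 Hu B3)) as [g Eg].
  { intros Y z v E. destruct (pb_ex pbo E) as (q & F1 & F2).
    exists (kl ⊚ q). cat. }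
  assert (Eg' : g ⊚ kb = u ⊚ kl) by (apply HpT; cat).
  assert (Hg : mono g) by (apply (mono_cancel (g := pT)); now rewrite Eg).
  (* [Kb21] also lies in [Kb1']: its part in O_1 lies in [Kb2], hence in [K21] and in [Kb1], which
     O_1 meets in K_1. *)
  destruct (fpc_factors (z := pS ⊚ g) (po_fpc Hro1 Hk1' pcS)) as [h Eh].
  { intros Y z v E.
    destruct (pb_ex (x := n1 ⊚ v) (y := g ⊚ z) pb4) as (q & F1 & F2); [cat|].
    destruct (pb_ex (x := o2 ⊚ q) (y := z) pbo) as (r & F3 & F4); [cat|].
    assert (F5 : q = kl ⊚ r) by (apply Ho2; cat).
    destruct (pb_ex (x := v) (y := kr ⊚ r) pbn) as (t & F6 & F7); [cat|].
    now exists t. }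
  assert (Hh : mono h).
  { apply (mono_cancel (g := d1)). rewrite Eh. now apply mono_cmp. }
  destruct (fpc_factors (z := nS ⊚ o1) (po_fpc Hro1 Hk1' pcS)) as [c Ec].
  { intros Y z v E.
    destruct (pb_ex (x := v) (y := z) pbn) as (q & F1 & F2); [apply HnS; cat|].
    now exists q. }
  assert (Hc : mono c).
  { apply (mono_cancel (g := d1)). rewrite Ec. now apply mono_cmp. }
  assert (Eck : c ⊚ k1 = k1') by (apply Hd1; cat).
  (* [HNK] and [HPg] compute the parts of [Kb1'] in [N] and in [P] as [Kb1] and [Kb21]. As [N] and
     [P] cover [S], the two glue to [Kb1']. *)
  assert (HNK : forall X (x : Hom X Kb1') (z : Hom X N), nS ⊚ z = d1 ⊚ x ->
    exists q, o1 ⊚ q = z /\ c ⊚ q = x).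
  { intros X x z E. destruct (po_local (x := z) (t := z) Hk1 pc Ho1) as [q F].
    - intros Y z' v F.
      destruct (pb_ex (x := v) (y := x ⊚ z') pbd) as (t & F1 & F2); [cat|].
      exists (k1 ⊚ t). cat.
    - intros Y z' v F. now exists v.
    - exists q. split; [exact F|]. apply Hd1. cat. }
  assert (HPg : forall X (z : Hom X P) (x : Hom X Kb1'), pS ⊚ z = d1 ⊚ x ->
    exists q, g ⊚ q = z /\ h ⊚ q = x).
  { intros X z x E. destruct (po_local (x := pT ⊚ z) (t := z) Hkb pcT Hg) as [q F].
    - intros Y z' v F.
      destruct (pb_ex (x := v) (y := z ⊚ z') pb3) as (q & F1 & F2); [cat|].
      destruct (HNK Y (x ⊚ z') (i2 ⊚ q)) as (r & F3 & F4); [cat|].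
      destruct (pb_ex (x := q) (y := r) pb) as (t & F5 & F6); [cat|].
      exists (kb ⊚ t). cat.
    - intros Y z' v F. exists v. apply HpT. cat.
    - exists q. split; [exact F|]. apply Hd1. cat. }
  assert (poC : is_pushout kr kb c h).
  { apply po_of_cover; auto.
    - apply pb_of_mono; auto; [apply Hd1; cat|]. intros X x z E.
      destruct (pb_ex (x := o1 ⊚ x) (y := g ⊚ z) pb4) as (q & F1 & F2); [cat|].
      destruct (pb_ex (x := q) (y := x) pb) as (t & F3 & F4); [cat|].
      now exists t.
    - intros Z s Hs [s2 G1] [s3 G2].
      apply (po_local (x := d1) Hu B4 Hs); intros Y z v E.
      + destruct (HNK Y z v E) as (q & F1 & F2). exists (s2 ⊚ q). cat.
      + destruct (HPg Y v z E) as (q & F1 & F2). exists (s3 ⊚ q). cat. }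
  destruct (po_ex (x := iib) (y := ib ⊚ c) poI) as (X21 & X1 & X2); [cat|].
  (* Both input objects extend [I21] by [Kb21] along [K21]. *)
  assert (poI' : is_pushout (i1 ⊚ kr) kb X21 (ib ⊚ h)).
  { apply po_sym. refine (po_paste (po_sym poC) (po_sym _)).
    apply (po_cancel poI); [|exact X2]. now rewrite Eck, X1. }
  destruct (po_iso (a := idm _) (b := idm _) (c := idm _) poIa poI'
    (iso_id _) (iso_id _) (iso_id _)) as (aI & HaI & I1 & I2); [cat|cat|].
  (* On the output side, the complement [Kb3] of [p3] in [T] is cut along the cover of [T] by [V]
     and [P]; its part in [V] is [Lb3]. *)
  destruct (fpc_factors (z := vT ⊚ li3) fpcT) as [a Ea].
  { intros Y z v E.
    destruct (pb_ex (x := v) (y := z) (fpc_pb fpcV)) as (q & F1 & F2); [apply HvT; cat|].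
    now exists q. }
  assert (Ha : mono a).
  { apply (mono_cancel (g := d3)). rewrite Ea. now apply mono_cmp. }
  assert (Eal : a ⊚ l3 = k3) by (apply Hd3; cat).
  assert (pbI := po_pb Hl2 poI2).
  assert (fpcP : is_FPC (nS ⊚ n2) (ri p2) pS (u ⊚ k2)).
  { exact (fpc_paste Hn2 Hri2 HnS HpS fpc (po_fpc Hi2 Hu B4)). }
  (* [Kb32] lies in [P]: its part in I_2 belongs to [I32], hence lies in [K32] and in [Lb2], which
     I_2 meets in K_2. *)
  destruct (fpc_factors (z := d2) fpcP) as [r Er].
  { intros Y z v E.
    destruct (pb_ex (x := e2 ⊚ v) (y := z) (fpc_pb fpcS)) as (q & F1 & F2); [cat|].
    destruct (pb_ex (x := v) (y := kr3 ⊚ q) pbI) as (t & F3 & F4); [cat|].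
    now exists t. }
  assert (Hr : mono r).
  { apply (mono_cancel (g := pS)). now rewrite Er. }
  assert (Erk : r ⊚ k2' = w ⊚ kr3) by (apply HpS; cat).
  assert (HwK : forall X (x : Hom X Kb32) (z : Hom X Lb2), w ⊚ z = r ⊚ x ->
    exists q, kr3 ⊚ q = z /\ k2' ⊚ q = x).
  { intros X x z E.
    destruct (pb_ex (x := e ⊚ z) (y := x) (fpc_pb fpcS)) as (q & F1 & F2); [cat|].
    exists q. split; [|exact F2]. apply He. cat. }
  destruct (fpc_factors (z := pT ⊚ r) fpcT) as [r' Er'].
  { intros Y z v E.
    destruct (pb_ex (x := v3 ⊚ v) (y := r ⊚ z) pb5) as (q & F1 & F2); [cat|].
    destruct (HwK Y z q F2) as (t & F3 & F4).
    destruct (pb_ex (x := v) (y := kl3 ⊚ t) (fpc_pb fpcV)) as (t' & F5 & F6); [cat|].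
    now exists t'. }
  assert (Hr' : mono r').
  { apply (mono_cancel (g := d3)). rewrite Er'. now apply mono_cmp. }
  (* The part of [Kb3] in [P] is [Kb32]: such an element, when in [I32], lies in [Lb2] by
     [bridge_pb]; being in [Kb3] it also lies in [Lb3], hence in [K32]. *)
  assert (HPr : forall X (z : Hom X P) (x : Hom X Kb3), pT ⊚ z = d3 ⊚ x ->
    exists q, r ⊚ q = z /\ r' ⊚ q = x).
  { intros X z x E. destruct (fpc_factors (z := pS ⊚ z) fpcS) as [q F].
    - intros Y y v F.
      destruct (pb_ex (x := v) (y := z ⊚ y) pbL) as (q & F1 & F2); [cat|].
      destruct (fpc_factors (z := lo ⊚ q) fpcV) as [t F3].
      + intros Y' y' v' F3.
        destruct (pb_ex (x := v') (y := x ⊚ y ⊚ y') (fpc_pb fpcT)) as (t & F4 & F5); [cat|].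
        now exists t.
      + destruct (pb_ex (x := t) (y := q) pbK) as (t' & F4 & F5); [exact F3|].
        exists t'. cat.
    - assert (F' : r ⊚ q = z) by (apply HpS; cat).
      exists q. split; [exact F'|]. apply Hd3. cat. }
  assert (poD : is_pushout kl3 k2' a r').
  { apply po_of_cover; auto.
    - apply pb_of_mono; auto; [apply Hd3; cat|]. intros X x z E.
      destruct (pb_ex (x := li3 ⊚ x) (y := r ⊚ z) pb5) as (q & F1 & F2); [cat|].
      destruct (pb_ex (x := x) (y := q) pbK) as (t & F3 & F4); [cat|].
      now exists t.
    - intros Z s Hs [s2 G1] [s3 G2].
      apply (po_local (x := d3) Hw B5 Hs); intros Y z v E.
      + destruct (fpc_factors (z := v) fpcV) as [q F].
        * intros Y' y' v' F.
          destruct (pb_ex (x := v') (y := z ⊚ y') (fpc_pb fpcT)) as (t & F1 & F2); [cat|].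
          now exists t.
        * exists (s2 ⊚ q). assert (a ⊚ q = z) by (apply Hd3; cat). cat.
      + destruct (HPr Y v z E) as (q & F1 & F2). exists (s3 ⊚ q). cat. }
  destruct (po_ex (x := oob ⊚ o3) (y := ob) poD) as (Y3 & Y1 & Y2); [cat|].
  (* Both output objects extend O_3 by [Kb3] along K_3. *)
  assert (poO' : is_pushout (ro p3) k3 (oob ⊚ oo3) Y3).
  { rewrite <- Eal. refine (po_paste poO3 (po_sym _)).
    apply (po_cancel (po_sym poD)); [|exact Y1].
    rewrite Y2. exact (po_sym poOb). }
  destruct (po_iso (a := idm _) (b := idm _) (c := idm _) poOa poO'
    (iso_id _) (iso_id _) (iso_id _)) as (aO & HaO & O1 & O2); [cat|cat|].
  (* [Ka] is the intersection of [Kb3] and [Kb21] in [T]. As [Kb21] is the part of [Kb1'] in [P],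
     this is what [Kb3] and [Kb1'] jointly cut out of [P], that is, the intersection of [Kb32] and
     [Kb1'] in [S]. *)
  destruct (HPr Ka (g ⊚ be) al) as (ga & G1 & G2); [cat|].
  assert (pbKa : is_pullback d2 d1 ga (h ⊚ be)).
  { apply pb_of_mono; auto.
    - apply (mono_cancel (g := r)). rewrite G1. now apply mono_cmp.
    - cat.
    - intros X x z E.
      destruct (HPg X (r ⊚ x) z) as (q & F1 & F2); [cat|].
      destruct (pb_ex (x := r' ⊚ x) (y := q) pba) as (t & F3 & F4); [cat|].
      exists t. apply Hr. cat. }
  destruct (pb_iso (a := idm _) (b := idm _) (d := idm _) pbKa pbb
    (iso_id _) (iso_id _) (iso_id _)) as (aK & HaK & K1 & K2); [cat|cat|].
  exists aO, aK, aI. cbn. conjs; auto; cat.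
Qed.

End Adhesive.

(** * From the relation to a bijection *)

Lemma match_iso_refl (C : Cat) (X Y : C) (m : Match X Y) : match_iso m m.
Proof. exists (idm _). rewrite !cmp_id_r. split; [apply iso_id|easy]. Qed.

Lemma witness_iso_refl (C : Cat) (p2 p1 : Rule C) (m : Match (rI p2) (rO p1))
  (W : CompW m) : witness_iso (W := W) (W' := W) (idm _) (idm _).
Proof.
  exists (idm _), (idm _), (idm _), (idm _).
  rewrite !cmp_id_l, !cmp_id_r. conjs; auto; apply iso_id.
Qed.

Lemma equivA_refl (C : Cat) (p1 p2 p3 : Rule C) (x : PairA p1 p2 p3) : equivA x x.
Proof.
  split; [apply match_iso_refl|]. exists (idm _), (idm _).
  split; [apply witness_iso_refl|].
  exists (idm _). cbn. rewrite !cmp_id_r, cmp_id_l. split; [apply iso_id|easy].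
Qed.

Lemma equivB_refl (C : Cat) (p1 p2 p3 : Rule C) (y : PairB p1 p2 p3) : equivB y y.
Proof.
  split; [apply match_iso_refl|]. exists (idm _), (idm _).
  split; [apply witness_iso_refl|].
  exists (idm _). cbn. rewrite !cmp_id_r, cmp_id_l. split; [apply iso_id|easy].
Qed.

Theorem mainTheorem2 (C : Cat)
    (HC : adhesive C) (Hfpc : all_FPCs_along_monos C)
    (Hstab : monos_stable_under_FPCs C)
    (p1 p2 p3 : Rule C)
    (H1 : linear p1) (H2 : linear p2) (H3 : linear p3) :
  exists (Phi : PairA p1 p2 p3 -> PairB p1 p2 p3)
         (Psi : PairB p1 p2 p3 -> PairA p1 p2 p3),
    (forall x y, equivA x y -> equivB (Phi x) (Phi y)) /\
    (forall x y, equivB x y -> equivA (Psi x) (Psi y)) /\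
    (forall x, equivA (Psi (Phi x)) x) /\
    (forall y, equivB (Phi (Psi y)) y) /\
    (forall x, corr x (Phi x)) /\
    (forall y, corr (Psi y) y).
Proof.
  pose proof (related_left_total HC Hfpc Hstab H1 H2 H3) as TA.
  pose proof (related_right_total HC Hfpc Hstab H1 H2 H3) as TB.
  pose proof (related_left_unique HC Hstab H1 H2 H3) as UA.
  pose proof (related_right_unique HC Hstab H1 H2 H3) as UB.
  (* Both maps choose from the same relation, so compatibility with the equivalences and the two
     round trips are instances of its uniqueness on either side. *)
  exists (fun x => proj1_sig (constructive_indefinite_description _ (TA x))),
    (fun y => proj1_sig (constructive_indefinite_description _ (TB y))).
  conjs.
  - intros x x'.
    destruct constructive_indefinite_description, constructive_indefinite_description.
    cbn. eauto.
  - intros y y'.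
    destruct constructive_indefinite_description, constructive_indefinite_description.
    cbn. eauto.
  - intros x.
    destruct (constructive_indefinite_description _ (TA x)) as [y Hy]; cbn.
    destruct (constructive_indefinite_description _ (TB y)) as [x' Hx']; cbn.
    exact (UB _ _ _ _ Hx' Hy (equivB_refl y)).
  - intros y.
    destruct (constructive_indefinite_description _ (TB y)) as [x Hx]; cbn.
    destruct (constructive_indefinite_description _ (TA x)) as [y' Hy']; cbn.
    exact (UA _ _ _ _ Hy' Hx (equivA_refl x)).
  - intros x. destruct constructive_indefinite_description as [y Hy]; cbn.
    exact (related_corr HC Hstab H1 H2 H3 Hy).
  - intros y. destruct constructive_indefinite_description as [x Hx]; cbn.
    exact (related_corr HC Hstab H1 H2 H3 Hx).
Qed.
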